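(* Suppose $X,Y$ are locally compact metric spaces, and $\mathcal{M}$ is a uniformly bounded in variation family of topological measures (respectively, deficient topological measures) on $Y$. Let $q_i$, $i=1,2,\ldots$, be image transformations (respectively, d-image transformations) from $X$ to $Y$, and let $\alpha_i\ge0$ with $\sum_{i=1}^\infty\alpha_i<\infty$. Then the operator $S:(\mathcal{M},wk)\to(\mathbf{TM}(X),wk)$ (respectively, $S:(\mathcal{M},wk)\to(\mathbf{DTM}(X),wk)$) given by $S(\mu)=\sum_{i=1}^\infty\alpha_i\,q_i^*(\mu)$ is a continuous Markov operator which preserves countable convex linear combinations. The image of $S$ is a uniformly bounded in variation family of topological measures (respectively, deficient topological measures) on $X$. On the collection of measures from $\mathcal{M}$, $S$ is a Markov-Feller operator with nonlinear dual operator $T=\sum_{i=1}^\infty\alpha_i\theta_i$, where each $\theta_i$ is the quasi-homomorphism (respectively, conic quasi-homomorphism) corresponding to $q_i$.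
   Context: All spaces are Hausdorff. $\mathscr{O}(X),\mathscr{C}(X),\mathscr{K}(X)$ denote the open, closed, compact subsets of $X$; $\sqcup$ is disjoint union. A topological measure on a locally compact $X$ is a map $\mu:\mathscr{C}(X)\cup\mathscr{O}(X)\to[0,\infty]$, not identically $\infty$, such that: (TM1) if $A,B,A\sqcup B\in\mathscr{K}(X)\cup\mathscr{O}(X)$ then $\mu(A\sqcup B)=\mu(A)+\mu(B)$; (TM2) $\mu(U)=\sup\{\mu(K):K\in\mathscr{K}(X),K\subseteq U\}$ for open $U$; (TM3) $\mu(F)=\inf\{\mu(U):U\in\mathscr{O}(X),F\subseteq U\}$ for closed $F$. If (TM1) is required only for compact $A,B$, $\mu$ is a deficient topological measure. $\|\mu\|=\mu(X)$; $\mathbf{TM}(X)$, $\mathbf{DTM}(X)$ are the sets of finite topological, finite deficient topological measures. A family $\mathcal{M}$ of finite (deficient) topological measures is uniformly bounded in variation if there is a constant $L>0$ with $\|\mu\|\le L$ for each $\mu\in\mathcal{M}$. ''$\mu$ is a measure'' means that $\mu$ is the restriction to $\mathscr{O}(X)\cup\mathscr{C}(X)$ of a Borel measure that is outer regular on Borel sets and inner compact regular on open sets. $C_0(X)$: continuous $f:X\to\mathbb{R}$ with $\{|f|\ge\epsilon\}$ compact for all $\epsilon>0$; $C_0^+(X)$: the nonnegative ones. Quasi-integral: for a finite deficient topological measure $\mu$ and $f\in C_0(X)$ with $f(X)\subseteq[a,b]$, $\int_X f\,d\mu=\int_a^b\mu(f^{-1}((t,\infty)))\,dt+a\,\mu(X)$.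 The weak topology $wk$ is the coarsest making $\mu\mapsto\int_X f\,d\mu$ continuous for all $f\in C_0^+(X)$. An image transformation from $X$ to $Y$ is a map $q:\mathscr{O}(X)\cup\mathscr{K}(X)\to\mathscr{O}(Y)\cup\mathscr{K}(Y)$ such that: $q$ takes open sets to open sets and compact sets to compact sets; $q(U)=\bigcup\{q(K):K\subseteq U,K\in\mathscr{K}(X)\}$ for open $U$; $q(K)=\bigcap\{q(U):K\subseteq U,U\in\mathscr{O}(X)\}$ for compact $K$; and $q(A\sqcup B)=q(A)\sqcup q(B)$ whenever $A,B,A\sqcup B\in\mathscr{O}(X)\cup\mathscr{K}(X)$. If the last property is required only for compact $A,B$, $q$ is a d-image transformation. Adjoint: $(q^*\nu)(A)=\nu(q(A))$ for $A$ open or compact in $X$ (extended to closed sets by (TM3)); $q^*$ maps topological measures on $Y$ to topological measures on $X$ if $q$ is an image transformation, and deficient topological measures to deficient ones if $q$ is a d-image transformation. The quasi-homomorphism (respectively, conic quasi-homomorphism) $\theta:C_0(X)\to C_0(Y)$ corresponding to $q$ is $\theta(f)(y)=\int_X f\,d(q^*\delta_y)$, $\delta_y$ the point mass at $y$ (in the conic case the one-to-one correspondence with d-image transformations is for $\theta:C_0^+(X)\to C_0^+(Y)$). Markov operator: $S(a\mu+b\nu)=aS(\mu)+bS(\nu)$ for $a,b\ge0$. Preserving countable convex linear combinations means $S(\sum_j\lambda_j\mu_j)=\sum_j\lambda_jS(\mu_j)$ for $\mu_j\in\mathcal{M}$, $\lambda_j\ge0$, $\sum_j\lambda_j=1$.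 Markov-Feller operator: a Markov operator $S$ for which there is an operator $T:C_0(X)\to C_0(Y)$, called dual to $S$, such that $\int_X f\,d(S(\mu))=\int_Y T(f)\,d\mu$ for all $f\in C_0(X)$ and all $\mu$ in the domain under consideration (here, the measures in $\mathcal{M}$).
   Formalization: For d-image transformations, T is stated as a map from C_0^+(X) to C_0^+(Y), since T f can fail to lie in C_0(Y) for signed f; for signed f in C_0(X) only the duality identity is stated, with T f integrated against the Borel measure extending μ. *)

(* Defs.v *)
From HB Require Import structures.
From mathcomp Require Import all_boot all_order all_algebra.
From mathcomp Require Import all_classical all_reals all_analysis.

Set Implicit Arguments.
Unset Strict Implicit.
Unset Printing Implicit Defensive.

Import Order.TTheory GRing.Theory Num.Theory.
Import numFieldNormedType.Exports.

Local Open Scope classical_set_scope.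
Local Open Scope ring_scope.
Local Open Scope ereal_scope.

(* A map defined on a family of subsets only (open and closed sets, or open
   and compact sets) is encoded as a total function on all subsets.  Its
   values outside that family are irrelevant: no axiom below mentions them,
   and two set functions are compared by [eq_oc]. *)

Section SetFunctions.
Context {R : realType} {X : topologicalType}.
Implicit Types (A B F U K : set X) (mu nu : set X -> \bar R).

Definition open_closed A : Prop := open A \/ closed A.
Definition open_compact A : Prop := open A \/ compact A.

Definition eq_oc mu nu : Prop := forall A, open_closed A -> mu A = nu A.

Definition inner_compact mu : Prop := forall U, open U ->
  mu U = ereal_sup [set mu K | K in [set K | compact K /\ K `<=` U]].

Definition outer_open_on (D : set (set X)) mu : Prop := forall F, D F ->
  mu F = ereal_inf [set mu U | U in [set U | open U /\ F `<=` U]].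

Record deficient_topological_measure mu : Prop := {
  dtm_ge0 : forall A, open_closed A -> 0 <= mu A ;
  dtm_neqy : exists2 A, open_closed A & mu A <> +oo ;
  dtm_add : forall A B, compact A -> compact B -> [disjoint A & B] ->
    mu (A `|` B) = mu A + mu B ;
  dtm_inner : inner_compact mu ;
  dtm_outer : outer_open_on closed mu
}.

Record topological_measure mu : Prop := {
  tm_ge0 : forall A, open_closed A -> 0 <= mu A ;
  tm_neqy : exists2 A, open_closed A & mu A <> +oo ;
  tm_add : forall A B,
    open_compact A -> open_compact B -> open_compact (A `|` B) ->
    [disjoint A & B] -> mu (A `|` B) = mu A + mu B ;
  tm_inner : inner_compact mu ;
  tm_outer : outer_open_on closed mu
}.

Definition TM : set (set X -> \bar R) :=
  [set mu | topological_measure mu /\ mu [set: X] < +oo].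

Definition DTM : set (set X -> \bar R) :=
  [set mu | deficient_topological_measure mu /\ mu [set: X] < +oo].

Definition uniformly_bounded (M : set (set X -> \bar R)) : Prop :=
  exists2 L : R, (0 < L)%R & forall mu, M mu -> mu [set: X] <= L%:E.

(* The measurable types of the library are pointed, whereas a metric space may
   be empty; hence Borel measures are phrased with the generated sigma-algebra
   [<<s open >>] rather than with [{measure set _ -> \bar R}]. *)
Record regular_borel_measure (m : set X -> \bar R) : Prop := {
  rbm0 : m set0 = 0 ;
  rbm_ge0 : forall A, <<s open >> A -> 0 <= m A ;
  rbm_sigma_additive : forall F : (set X)^nat,
    (forall i, <<s open >> (F i)) -> trivIset setT F ->
    m (\bigcup_i F i) = \sum_(0 <= i <oo) m (F i) ;
  rbm_inner : inner_compact m ;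
  rbm_outer : outer_open_on <<s open >> m
}.

Definition restricts_to (m mu : set X -> \bar R) : Prop :=
  regular_borel_measure m /\ eq_oc m mu.

Definition is_measure mu : Prop := exists m, restricts_to m mu.

Definition C0 : set (X -> R) := [set f | continuous f /\
  forall e : R, (0 < e)%R -> compact [set x | (e <= `|f x|)%R]].

Definition C0pos : set (X -> R) := [set f | C0 f /\ forall x, (0 <= f x)%R].

(* The interval [a, b] containing the range is chosen arbitrarily; for a
   finite deficient topological measure the value does not depend on it. *)
Definition qint mu (f : X -> R) : R :=
  let ab := xget (0%R, 0%R)
    [set ab : R * R | forall x, (ab.1 <= f x <= ab.2)%R] in
  fine (\int[lebesgue_measure]_(t in `[ab.1, ab.2])
          mu (f @^-1` [set s | (t < s)%R])
        + ab.1%:E * mu [set: X]).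

Definition point_mass (y : X) : set X -> \bar R := fun A => (\1_A y)%:E.

End SetFunctions.

Arguments TM R X : clear implicits.
Arguments DTM R X : clear implicits.
Arguments C0 R X : clear implicits.
Arguments C0pos R X : clear implicits.

(* All set functions on X with the coarsest topology making mu |-> qint mu f
   continuous for every nonnegative f in C0.  The topology wk on TM, DTM or a
   subfamily is the induced one, i.e. the coarsest topology on that family with
   the same property. *)
Definition wk (R : realType) (X : topologicalType) : Type := set X -> \bar R.

Section WeakTopology.
Context (R : realType) (X : topologicalType).

HB.instance Definition _ := Choice.copy (wk R X) (set X -> \bar R).

Definition wk_functional (f : {f : X -> R | C0pos R X f}) (mu : wk R X) : R :=
  qint mu (sval f).

HB.instance Definition _ := Topological.copy (wk R X)
  (sup_topology (fun f : {f : X -> R | C0pos R X f} =>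
     Topological.on (initial_topology (wk_functional f)))).

Lemma wk_functional_continuous (f : {f : X -> R | C0pos R X f}) :
  continuous (wk_functional f : wk R X -> R).
Proof.
apply/continuousP => A oA; rewrite openE => mu Amu.
have [+ _] := @cvg_sup _ _ (fun f : {f : X -> R | C0pos R X f} =>
  Topological.on (initial_topology (wk_functional f))) (nbhs (mu : wk R X)) mu _.
move=> /(_ (fun _ x => x) f); apply; rewrite nbhsE.
by exists (wk_functional f @^-1` A) => //; split => //; exists A.
Qed.

Lemma wk_coarsest (Z : topologicalType) (g : Z -> wk R X) :
  (forall f, continuous (wk_functional f \o g)) -> continuous g.
Proof.
move=> gc z; apply/(@cvg_sup _ _ (fun f : {f : X -> R | C0pos R X f} =>
  Topological.on (initial_topology (wk_functional f)))).
move=> f A; rewrite nbhsE => -[B [[C oC <-] Bg] BA].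
have W : nbhs z ((wk_functional f \o g) @^-1` C).
  by apply: (gc f z); apply: open_nbhs_nbhs.
by apply: filterS W => t /= Ct; exact: BA.
Qed.

End WeakTopology.

Section ImageTransformations.
Context {R : realType} {X Y : topologicalType}.
Implicit Types (q : set X -> set Y) (nu : set Y -> \bar R).

Record d_image_transformation q : Prop := {
  dit_open : forall U, open U -> open (q U) ;
  dit_compact : forall K, compact K -> compact (q K) ;
  dit_inner : forall U, open U ->
    q U = \bigcup_(K in [set K | compact K /\ K `<=` U]) q K ;
  dit_outer : forall K, compact K ->
    q K = \bigcap_(U in [set U | open U /\ K `<=` U]) q U ;
  dit_disjoint : forall A B, compact A -> compact B -> [disjoint A & B] ->
    [disjoint q A & q B] /\ q (A `|` B) = q A `|` q B
}.

Record image_transformation q : Prop := {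
  it_open : forall U, open U -> open (q U) ;
  it_compact : forall K, compact K -> compact (q K) ;
  it_inner : forall U, open U ->
    q U = \bigcup_(K in [set K | compact K /\ K `<=` U]) q K ;
  it_outer : forall K, compact K ->
    q K = \bigcap_(U in [set U | open U /\ K `<=` U]) q U ;
  it_disjoint : forall A B,
    open_compact A -> open_compact B -> open_compact (A `|` B) ->
    [disjoint A & B] -> [disjoint q A & q B] /\ q (A `|` B) = q A `|` q B
}.

Definition adjoint q nu : set X -> \bar R := fun A =>
  if `[< open_compact A >] then nu (q A)
  else ereal_inf [set nu (q U) | U in [set U | open U /\ A `<=` U]].

Definition quasi_hom q (f : X -> R) : Y -> R :=
  fun y => qint (adjoint q (point_mass y)) f.

Definition series_adjoint (alpha : R^nat) (q : nat -> set X -> set Y) :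
    wk R Y -> wk R X :=
  fun mu A => \sum_(0 <= i <oo) (alpha i)%:E * adjoint (q i) mu A.

Definition series_quasi_hom (alpha : R^nat) (q : nat -> set X -> set Y)
    (f : X -> R) : Y -> R :=
  fun y => limn (series (fun i => (alpha i * quasi_hom (q i) f y)%R)).

Implicit Types (M : set (wk R Y)) (S : wk R Y -> wk R X).

Definition markov_operator M S : Prop :=
  forall (a b : R) mu nu, (0 <= a)%R -> (0 <= b)%R -> M mu -> M nu ->
    eq_oc (S (fun A => a%:E * mu A + b%:E * nu A))
          (fun A => a%:E * S mu A + b%:E * S nu A).

Definition preserves_countable_convex M S : Prop :=
  forall (lambda : R^nat) (mu : nat -> wk R Y),
    (forall j, (0 <= lambda j)%R) ->
    \sum_(0 <= j <oo) (lambda j)%:E = 1 ->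
    (forall j, M (mu j)) ->
    eq_oc (S (fun A => \sum_(0 <= j <oo) (lambda j)%:E * mu j A))
          (fun A => \sum_(0 <= j <oo) (lambda j)%:E * S (mu j) A).

(* D and E are the function classes between which the dual operator T acts:
   C0 and C0 for image transformations, C0pos and C0pos in the conic case.  For
   a d-image transformation q and a signed f in C0, quasi_hom q f need not be
   in C0: with X = Y = the real line and q A = [set y | `[0, |y|] `<=` A], the
   function quasi_hom q f is y |-> inf of f over `[0, |y|]. *)
Definition markov_feller (D : set (X -> R)) (E : set (Y -> R)) M S
    (T : (X -> R) -> (Y -> R)) : Prop :=
  [/\ markov_operator M S,
      forall f, D f -> E (T f) &
      forall f mu, D f -> M mu -> qint (S mu) f = qint mu (T f)].

End ImageTransformations.

(* Main.v *)
(* For each i, compactness arguments show that q_i^* preserves (deficient)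
   topological measures; sums with summable coefficients commute with the
   directed suprema and infima expressing regularity, which gives the same for
   S, and linearity of S by exchanging the order of summation.

   For y in q(X), theta f (y) > t iff y lies in q({f > t}), while theta f = 0
   off q(X).  Hence theta f is in C_0^+ when f is (in C_0 when q is an image
   transformation), and comparing distribution functions gives
   qint (q^* mu) f = qint mu (theta f) for f in C_0^+.  Summing over i with the
   bound |qint mu (theta_i f)| <= c L yields a uniformly convergent series of
   weakly continuous functionals.

   For a signed f and a measure m, the superlevel sets of theta f are those of
   q({f > t}), augmented for t < 0 by the complement of q(X); additivity of m
   again gives qint m (theta f) = qint (q^* m) f, and the layer cake formula
   turns qint m into an honest integral, which is countably additive. *)
From HB Require Import structures.
Require Import Defs.
From mathcomp Require Import all_boot all_order all_algebra.
From mathcomp Require Import all_classical all_reals all_analysis.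
From mathcomp Require Import measurable_realfun ring lra.
Import Order.TTheory GRing.Theory Num.Theory.
Import numFieldNormedType.Exports.
Local Open Scope classical_set_scope.
Local Open Scope ring_scope.

Set Implicit Arguments.
Unset Strict Implicit.
Unset Printing Implicit Defensive.

(** Apart from full additivity and from membership in C0 for signed f, everything is proved for
    d-image transformations and deficient topological measures, so both halves share one
    development. The axioms for q concern open and compact subsets of X, whereas regularity of q^*
    nu compares q(A) with arbitrary open and compact subsets of Y. Local compactness is the link:
    between a compact K and an open U around it fit an open V and a compact C containing V, so the
    sets q(V) form a directed open cover, the sets q(C) a directed family of compact sets, and
    compactness in Y selects a single one.

    The quasi-integral is linear in the set function but not in the function. Hence weak continuity
    comes from the series of qint mu (theta_i f), not from qint mu (T f), and the dual formula is
    confined to measures. For signed f and a d-image transformation, a superlevel set of theta f at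
    a negative level is a union of an open and a closed set, where the values of mu carry no
    meaning; the Borel measure m has to be evaluated there. *)

(** * Exchange of nonnegative series with directed suprema and infima *)

Section NonnegativeSeries.
Context {R : realType} {X : Type}.
Local Open Scope ereal_scope.
Implicit Types (D : set (set X)) (c : nat -> set X -> \bar R).

Lemma finite_upper_bound D (s : nat -> set X) n : D !=set0 -> setU_closed D ->
  (forall i, D (s i)) -> exists2 K, D K & forall i, (i < n)%N -> s i `<=` K.
Proof.
move=> [K0 DK0] DU Ds; elim: n => [|n [K DK sK]]; first by exists K0.
exists (K `|` s n) => [|i]; first exact: DU.
by rewrite ltnS leq_eqVlt => /predU1P[->|/sK]; [right|move=> h x /h; left].
Qed.

Lemma finite_lower_bound D (s : nat -> set X) n : D !=set0 -> setI_closed D ->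
  (forall i, D (s i)) -> exists2 K, D K & forall i, (i < n)%N -> K `<=` s i.
Proof.
move=> [K0 DK0] DI Ds; elim: n => [|n [K DK sK]]; first by exists K0.
exists (K `&` s n) => [|i]; first exact: DI.
by rewrite ltnS leq_eqVlt => /predU1P[->|/sK h] x []// /h.
Qed.

(** Near-maximisers with errors [e / 2 ^ i.+1], one for each i < n, lie in a single member of [D]
    because [D] is stable under unions; monotonicity transfers the estimate to that member.
    Finiteness of the suprema provides the near-maximisers. *)
Lemma nneseries_ereal_sup D c : D !=set0 -> setU_closed D ->
  (forall i K, D K -> 0 <= c i K) ->
  (forall i K L, D K -> D L -> K `<=` L -> c i K <= c i L) ->
  (forall i, ereal_sup [set c i K | K in D] < +oo) ->
  \sum_(0 <= i <oo) ereal_sup [set c i K | K in D] =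
  ereal_sup [set \sum_(0 <= i <oo) c i K | K in D].
Proof.
move=> D0 DU c0 cS cfin; have [K0 DK0] := D0.
have sup0 i : 0 <= ereal_sup [set c i K | K in D].
  by apply: le_trans (c0 i _ DK0) _; apply: ereal_sup_ubound; exists K0.
apply/eqP; rewrite eq_le; apply/andP; split; last first.
  apply: ge_ereal_sup => _ [K DK <-]; apply: lee_nneseries => [i _ _|i _].
    exact: c0.
  by apply: ereal_sup_ubound; exists K.
apply: lime_le; first exact: is_cvg_nneseries.
apply: nearW => n; apply/lee_addgt0Pr => e e0.
have ei (i : nat) : (0 < e / (2 ^ i.+1)%:R)%R by rewrite divr_gt0.
have /choice[s sP] : forall i, exists K, D K /\
    ereal_sup [set c i K | K in D] <= c i K + (e / (2 ^ i.+1)%:R)%:E.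
  move=> i.
  have supf : ereal_sup [set c i K | K in D] \is a fin_num.
    by rewrite ge0_fin_numE.
  have [_ [K DK <-]] := ub_ereal_sup_adherent (ei i) supf.
  by rewrite lteBlDr// => /ltW; exists K.
have [K DK sK] := finite_upper_bound n D0 DU (fun i => (sP i).1).
apply: (@le_trans _ _ (\sum_(0 <= i < n) (c i K + (e / (2 ^ i.+1)%:R)%:E))).
  rewrite !big_mkord; apply: lee_sum => i _; apply: le_trans (sP i).2 _.
  by rewrite leeD2r//; apply: cS => //; [exact: (sP i).1|exact: sK].
have h i : 0 <= c i K + (e / (2 ^ i.+1)%:R)%:E.
  by rewrite adde_ge0 ?c0// lee_fin ltW.
apply: (le_trans (nneseries_lim_ge n (fun i _ _ => h i))).
apply: (le_trans (epsilon_trick xpredT (fun i => c0 i K DK) (ltW e0))).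
by rewrite leeD2r//; apply: ereal_sup_ubound; exists K.
Qed.

(** A common lower bound controls finitely many terms only; the remaining ones are controlled by the
    tail of the convergent series at [K0]. *)
Lemma nneseries_ereal_inf D c K0 : D K0 -> setI_closed D ->
  (forall i K, D K -> 0 <= c i K) ->
  (forall i K L, D K -> D L -> K `<=` L -> c i K <= c i L) ->
  \sum_(0 <= i <oo) c i K0 < +oo ->
  \sum_(0 <= i <oo) ereal_inf [set c i K | K in D] =
  ereal_inf [set \sum_(0 <= i <oo) c i K | K in D].
Proof.
move=> DK0 DI c0 cS cfin; have D0 : D !=set0 by exists K0.
have inf0 i : 0 <= ereal_inf [set c i K | K in D].
  by apply: le_ereal_inf_tmp => _ [K DK <-]; exact: c0.
apply/eqP; rewrite eq_le; apply/andP; split.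
  apply: le_ereal_inf_tmp => _ [K DK <-]; apply: lee_nneseries => // i _.
  by apply: ereal_inf_lbound; exists K.
have ci i : c i K0 < +oo.
  apply: le_lt_trans cfin; rewrite (@nneseriesD1 _ (fun i => c i K0) i xpredT)//; last first.
    by move=> k _; exact: c0.
  by rewrite leeDl// nneseries_ge0// => k _ _; exact: c0.
apply/lee_addgt0Pr => e e0; have e20 : (0 < e / 2)%R by rewrite divr_gt0.
have ei (i : nat) : (0 < e / 2 / (2 ^ i.+1)%:R)%R by rewrite divr_gt0.
have /choice[s sP] : forall i, exists K, D K /\
    c i K <= ereal_inf [set c i K | K in D] + (e / 2 / (2 ^ i.+1)%:R)%:E.
  move=> i.
  have inff : ereal_inf [set c i K | K in D] \is a fin_num.
    rewrite ge0_fin_numE//; apply: le_lt_trans (ci i).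
    by apply: ereal_inf_lbound; exists K0.
  have [_ [K DK <-] /ltW ?] := lb_ereal_inf_adherent (ei i) inff.
  by exists K.
have [n nP] : exists n, \sum_(n <= i <oo) c i K0 <= (e / 2)%:E.
  have := @nneseries_tail_cvg _ (fun i => c i K0) xpredT cfin (fun i _ => c0 i _ DK0).
  move=> /fine_cvgP[[n1 _ fin]] /cvgrPdist_lt /(_ _ e20)[n2 _ cv].
  exists (maxn n1 n2).
  have /= := cv (maxn n1 n2) (leq_maxr _ _).
  rewrite sub0r normrN => /(le_lt_trans (ler_norm _))/ltW.
  by rewrite -lee_fin fineK//; exact/fin/leq_maxl.
have [K DK sK] := finite_lower_bound n D0 DI (fun i => (sP i).1).
(* [K] takes care of the terms before n, and intersecting with [K0] keeps the tail from n on below e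
   / 2. *)
pose K1 := K `&` K0; have DK1 : D K1 by exact: DI.
apply: (@le_trans _ _ (\sum_(0 <= i <oo) c i K1)).
  by apply: ereal_inf_lbound; exists K1.
rewrite (nneseries_split 0 n); last by move=> k _; exact: c0.
rewrite add0n [e]splitr EFinD addeA; apply: leeD.
  apply: le_trans (epsilon_trick xpredT inf0 (ltW e20)).
  apply: (@le_trans _ _ (\sum_(0 <= i < n)
     (ereal_inf [set c i K | K in D] + (e / 2 / (2 ^ i.+1)%:R)%:E))).
    rewrite !big_mkord; apply: lee_sum => i _; apply: le_trans _ (sP i).2.
    apply: cS => //; first exact: (sP i).1.
    by move=> x [/(sK i (ltn_ord i))].
  apply: nneseries_lim_ge => i _ _.
  by rewrite adde_ge0// lee_fin ltW.
apply: le_trans nP; apply: lee_nneseries => [i _ _|i _]; first exact: c0.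
by apply: cS => // x [].
Qed.

End NonnegativeSeries.

(** * Compactness for directed families, and interposition *)

Section Compactness.
Context {X : topologicalType}.
Implicit Types (D : set (set X)) (K U V W C : set X).

(** If no member covered K, the sets K minus U would generate a proper filter; its cluster point in
    K lies in some open member U, and the neighbourhood U cannot meet K minus U. *)
Lemma compact_directed_cover D K : compact K ->
  D !=set0 -> (forall U V, D U -> D V -> exists2 W, D W & U `|` V `<=` W) ->
  (forall U, D U -> open U) -> K `<=` \bigcup_(U in D) U -> exists2 U, D U & K `<=` U.
Proof.
move=> cK [U0 DU0] DU Do KD; apply: contrapT => nU.
pose F := filter_from D (fun U => K `\` U).
have FF : Filter F.
  apply: filter_from_filter; first by exists U0.
  move=> U V HU HV; have [W DW UVW] := DU U V HU HV; exists W => //.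
  by move=> x [Kx nx]; split; split => // h; apply: nx; apply: UVW; [left|right].
have PF : ProperFilter F.
  apply: Build_ProperFilter_ex => A [U HU UA]; apply: contrapT => nA; apply: nU.
  exists U => // x Kx; apply: contrapT => nUx; apply: nA.
  by exists x; apply: UA; split.
have FK : F K by exists U0 => // x [].
have [x [Kx clx]] := cK F PF FK.
have [U HU Ux] := KD x Kx.
have FU : F (K `\` U) by exists U.
have nU' : nbhs x U by apply: open_nbhs_nbhs; split => //; exact: Do.
by have [y [[_ +]]] := clx _ _ FU nU'.
Qed.

(** The complements of the members form a directed open cover of the compact set K0 minus W. The
    member so found is good only inside K0, hence the final passage to a member contained in
    both. *)
Lemma compact_directed_bigcap D W : hausdorff_space X ->
  D !=set0 -> (forall K L, D K -> D L -> exists2 M, D M & M `<=` K `&` L) ->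
  (forall K, D K -> compact K) -> open W -> \bigcap_(K in D) K `<=` W -> exists2 K, D K & K `<=` W.
Proof.
move=> hX [K0 DK0] DI Dc oW DW.
have cK0W : compact (K0 `&` ~` W).
  by apply: compact_closedI; [exact: Dc|exact: open_closedC].
have [_ [K DK <-] KW] : exists2 U, [set ~` K | K in D] U & K0 `&` ~` W `<=` U.
  apply: compact_directed_cover => //.
  - by exists (~` K0), K0.
  - move=> _ _ [K DK <-] [L DL <-]; have [M DM MKL] := DI K L DK DL.
    by exists (~` M); [exists M|rewrite -setCI; exact: subsetC].
  - by move=> _ [K DK <-]; exact: (closed_openC (compact_closed hX (Dc _ DK))).
  - move=> x [K0x nWx]; have : ~ (\bigcap_(K in D) K) x by move=> /DW.
    move=> /existsNP[K] /not_implyP[DK nKx].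
    by exists (~` K) => //; exists K.
have [M DM MK] := DI K0 K DK0 DK; exists M => // x /MK[K0x Kx].
by apply: contrapT => nWx; exact: (KW x (conj K0x nWx)).
Qed.

(** The admissible V are stable under finite unions, so a single point suffices: take the interior
    of the intersection of a neighbourhood N with closure inside U and a compact neighbourhood B. *)
Lemma compact_interposition K U : locally_compact [set: X] -> regular_space X ->
  compact K -> open U -> K `<=` U ->
  exists V C, [/\ open V, compact C, K `<=` V, V `<=` C & C `<=` U].
Proof.
move=> lX rX cK oU KU.
have [V [oV [C [cC VC CU]]] KV] : exists2 V, [set V | open V /\
    exists C, [/\ compact C, V `<=` C & C `<=` U]] V & K `<=` V.
  apply: compact_directed_cover => //.
  - exists set0; split; first exact: open0.
    by exists set0; split => //; exact: compact0.
  - move=> V V' [oV [C [cC VC CU]]] [oV' [C' [cC' VC' CU']]].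
    exists (V `|` V') => //; split; first exact: openU.
    exists (C `|` C'); split; first exact: compactU.
      exact: setUSS.
    by rewrite subUset.
  - by move=> V [].
  - move=> x Kx.
    have nU : nbhs x U by apply: open_nbhs_nbhs; split => //; exact: KU.
    have [N nN NU] := rX x U nU.
    have [B + [cB clB]] := lX x I; rewrite withinET => nB.
    exists (N `&` B)°; last by apply: filterI.
    split; first exact: open_interior.
    exists (closure N `&` B); split.
    + rewrite setIC; apply: compact_closedI => //; exact: closed_closure.
    + by move=> y /interior_subset[/subset_closure].
    + by move=> y [/NU].
by exists V, C.
Qed.

End Compactness.

(** * Deficient topological measures and their weighted series *)

Section DeficientTopologicalMeasures.
Context {R : realType} {X : topologicalType}.
Local Open Scope ereal_scope.
Implicit Types (mu : set X -> \bar R) (A B : set X).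

Lemma topological_measure_deficient mu :
  topological_measure mu -> deficient_topological_measure mu.
Proof.
case=> ge0 neqy add inn out; split => // A B cA cB; apply: add; right => //.
exact: compactU.
Qed.

Lemma TM_DTM : TM R X `<=` DTM R X.
Proof. by move=> mu [/topological_measure_deficient]. Qed.

(** Monotonicity comes from regularity: inner regularity for two open sets, the outer formula in the
    other cases. *)
Lemma dtm_le mu A B : deficient_topological_measure mu ->
  open_closed A -> open_closed B -> A `<=` B -> mu A <= mu B.
Proof.
move=> dmu oA oB AB; have [_ _ _ inn out] := dmu.
have le_open U V : open U -> open V -> U `<=` V -> mu U <= mu V.
  move=> oU oV UV; rewrite (inn U)// (inn V)//; apply: ereal_sup_le.
  by move=> _ [K [cK KU] <-]; exists K => //; split => // x /KU/UV.
case: oA => [oA|clA]; case: oB => [oB|clB].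
- exact: le_open.
- rewrite (out B)//; apply: le_ereal_inf_tmp => _ [U [oU BU] <-].
  by apply: le_open => // x /AB/BU.
- by rewrite (out A)//; apply: ereal_inf_lbound; exists B.
- rewrite (out A)// (out B)//; apply: ereal_inf_le_tmp.
  by move=> _ [U [oU BU] <-]; exists U => //; split => // x /AB/BU.
Qed.

(** The empty set is its own disjoint double, so its measure equals twice itself; it is finite
    because it lies below some finite value. *)
Lemma dtm_set0 mu : deficient_topological_measure mu -> mu set0 = 0.
Proof.
move=> dmu; have [A oA Ay] := dtm_neqy dmu.
have o0 : open_closed (set0 : set X) by left; exact: open0.
have mu0 : mu set0 \is a fin_num.
  rewrite ge0_fin_numE; last exact: dtm_ge0.
  apply: (@le_lt_trans _ _ (mu A)); last by rewrite ltey; exact/eqP.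
  exact: dtm_le.
have := dtm_add dmu (@compact0 X) (@compact0 X); rewrite disj_set2E set0I.
move=> /(_ (eqxx _)); rewrite setU0.
by move: mu0; case: (mu set0) => [r _ [] r2| |]//; congr EFin; lra.
Qed.

Lemma dtm_fin_num mu A : DTM R X mu -> open_closed A -> mu A \is a fin_num.
Proof.
move=> [dmu muT] oA; rewrite ge0_fin_numE ?(dtm_ge0 dmu)//.
by apply: le_lt_trans muT; apply: dtm_le => //; left; exact: openT.
Qed.

Lemma open_closed_compact A : hausdorff_space X -> open_compact A -> open_closed A.
Proof. by move=> hX [|/(compact_closed hX)]; [left|right]. Qed.

End DeficientTopologicalMeasures.

Section SeriesOfDTM.
Context {R : realType} {X : topologicalType}.
Hypothesis hX : hausdorff_space X.
Local Open Scope ereal_scope.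
Variables (c : R^nat) (nu : nat -> set X -> \bar R).
Hypotheses (c_ge0 : forall i, (0 <= c i)%R) (nu_dtm : forall i, DTM R X (nu i)).
Hypothesis c_nu : \sum_(0 <= i <oo) (c i)%:E * nu i [set: X] < +oo.

Let m : set X -> \bar R := fun A => \sum_(0 <= i <oo) (c i)%:E * nu i A.

Let term_ge0 i A : open_closed A -> 0 <= (c i)%:E * nu i A.
Proof.
by move=> oA; rewrite mule_ge0 ?lee_fin//; exact: (dtm_ge0 (nu_dtm i).1).
Qed.

Let term_le i A B : open_closed A -> open_closed B -> A `<=` B ->
  (c i)%:E * nu i A <= (c i)%:E * nu i B.
Proof.
move=> oA oB AB; rewrite lee_wpmul2l ?lee_fin//.
exact: (dtm_le (nu_dtm i).1).
Qed.

Lemma series_ge0 A : open_closed A -> 0 <= m A.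
Proof. by move=> oA; apply: nneseries_ge0 => i _ _; exact: term_ge0. Qed.

Lemma series_add A B : open_closed A -> open_closed B ->
  (forall i, nu i (A `|` B) = nu i A + nu i B) -> m (A `|` B) = m A + m B.
Proof.
move=> oA oB AB; rewrite /m -nneseriesD; last 2 first.
- by move=> i _ _; exact: term_ge0.
- by move=> i _ _; exact: term_ge0.
by apply: eq_eseriesr => i _; rewrite AB muleDr//= ge0_adde_def// inE;
  exact: (dtm_ge0 (nu_dtm i).1).
Qed.

Lemma series_inner : inner_compact m.
Proof.
move=> U oU; rewrite -nneseries_ereal_sup.
- apply: eq_eseriesr => i _; rewrite (dtm_inner (nu_dtm i).1)//.
  rewrite -ereal_supZl//; last first.
    by apply/set0P; exists (nu i set0), set0 => //; split => //; exact: compact0.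
  by rewrite image_comp.
- by exists set0; split => //; exact: compact0.
- by move=> K L [cK KU] [cL LU]; split; [exact: compactU|rewrite subUset].
- by move=> i K [cK _]; apply: term_ge0; right; exact: compact_closed.
- by move=> i K L [cK _] [cL _]; apply: term_le; right; exact: compact_closed.
- move=> i; apply: (@le_lt_trans _ _ ((c i)%:E * nu i U)).
    apply: ge_ereal_sup => _ [K [cK KU] <-]; apply: term_le => //.
      by right; exact: compact_closed.
    by left.
  rewrite -ge0_fin_numE; last by apply: term_ge0; left.
  by rewrite fin_numM// dtm_fin_num//; left.
Qed.

(** The set A is arbitrary because [adjoint] is such an infimum on every set that is neither open
    nor compact. The whole space, where the series is finite, plays the role of [K0] in the
    exchange. *)
Lemma series_ereal_inf A :
  \sum_(0 <= i <oo) (c i)%:E *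
    ereal_inf [set nu i U | U in [set U | open U /\ A `<=` U]] =
  ereal_inf [set m U | U in [set U | open U /\ A `<=` U]].
Proof.
have DT : [set U | open U /\ A `<=` U] [set: X] by split => //; exact: openT.
rewrite -(nneseries_ereal_inf DT)//.
- apply: eq_eseriesr => i _.
  rewrite [RHS](_ : _ = ereal_inf [set (c i)%:E * x |
      x in [set nu i U | U in [set U | open U /\ A `<=` U]]]); last first.
    by rewrite image_comp.
  (* Only a positive factor passes through the infimum directly; for a zero coefficient both sides
     are 0, the family of open supersets being non-empty. *)
  have := c_ge0 i; rewrite le_eqVlt => /predU1P[<-|ci0].
    rewrite mul0e; under eq_imagel do rewrite mul0e.
    by rewrite ereal_inf_cst//; apply/set0P; exists (nu i setT), setT.
  by rewrite ereal_inf_pZl.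
- by move=> U V [oU AU] [oV AV]; split; [exact: openI|rewrite subsetI].
- by move=> i U [oU _]; apply: term_ge0; left.
- by move=> i U V [oU _] [oV _]; apply: term_le; left.
Qed.

Lemma series_outer : outer_open_on closed m.
Proof.
move=> F clF; rewrite -series_ereal_inf; apply: eq_eseriesr => i _.
by rewrite (dtm_outer (nu_dtm i).1).
Qed.

Lemma series_dtm : DTM R X m.
Proof.
split=> //; split.
- exact: series_ge0.
- by exists setT; [left; exact: openT|apply/eqP; rewrite lt_eqF].
- move=> A B cA cB AB; apply: series_add; try by right; exact: compact_closed.
  by move=> i; exact: (dtm_add (nu_dtm i).1).
- exact: series_inner.
- exact: series_outer.
Qed.

Lemma series_tm : (forall i, topological_measure (nu i)) -> TM R X m.
Proof.
move=> nu_tm; split=> //; split.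
- exact: series_ge0.
- by exists setT; [left; exact: openT|apply/eqP; rewrite lt_eqF].
- move=> A B oA oB oAB AB; apply: series_add; try exact: open_closed_compact.
  by move=> i; exact: (tm_add (nu_tm i)).
- exact: series_inner.
- exact: series_outer.
Qed.

End SeriesOfDTM.

(** * Monotonicity and semicontinuity of image transformations *)

Section ImageTransformations.
Context {X Y : topologicalType}.
Implicit Types (q : set X -> set Y) (A B : set X).

Lemma image_transformation_d q : image_transformation q -> d_image_transformation q.
Proof.
case=> qo qc inn out dis; split => // A B cA cB; apply: dis; right => //.
exact: compactU.
Qed.

(** The outer formula gives the case of two compact sets, and the inner formula reduces the cases
    with an open set to compact subsets. *)
Lemma dit_le q A B : d_image_transformation q ->
  open_compact A -> open_compact B -> A `<=` B -> q A `<=` q B.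
Proof.
move=> dq oA oB AB.
have le_compact K L : compact K -> compact L -> K `<=` L -> q K `<=` q L.
  move=> cK cL KL; rewrite (dit_outer dq cK) (dit_outer dq cL) => y qy U [oU LU].
  by apply: qy; split => // x /KL/LU.
case: oB => [oB|cB]; case: oA => [oA|cA].
- rewrite (dit_inner dq oA) (dit_inner dq oB) => y [K [cK KA] qy].
  by exists K => //; split => // x /KA/AB.
- by rewrite (dit_inner dq oB) => y qy; exists A.
- rewrite (dit_inner dq oA) => y [K [cK KA]].
  by apply: le_compact => // x /KA/AB.
- exact: le_compact.
Qed.

(** The image of the empty set is disjoint from itself. *)
Lemma dit_set0 q : d_image_transformation q -> q set0 = set0.
Proof.
move=> dq; have := dit_disjoint dq (@compact0 X) (@compact0 X).
by rewrite !disj_set2E set0I eqxx => /(_ isT)[/eqP]; rewrite setIid.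
Qed.

Lemma dit_sub_setT q A : d_image_transformation q -> open_compact A ->
  q A `<=` q [set: X].
Proof. by move=> dq oA; apply: dit_le => //; left; exact: openT. Qed.

(** Upper semicontinuity of q at compact sets: q(K) is the intersection of q(C) over the compact
    neighbourhoods C of K, a directed family, so one q(C) already lies in W. *)
Lemma dit_compact_sub q (K : set X) (W : set Y) : hausdorff_space X ->
  hausdorff_space Y -> locally_compact [set: X] -> regular_space X ->
  d_image_transformation q -> compact K -> open W -> q K `<=` W ->
  exists U, [/\ open U, K `<=` U & q U `<=` W].
Proof.
move=> hX hY lX rX dq cK oW KW.
pose D := [set C | compact C /\ exists2 V, open V & K `<=` V /\ V `<=` C].
have DI C1 C2 : D C1 -> D C2 -> D (C1 `&` C2).
  move=> [cC1 [V1 oV1 [KV1 VC1]]] [cC2 [V2 oV2 [KV2 VC2]]]; split.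
    exact: (compact_closedI cC1 (compact_closed hX cC2)).
  by exists (V1 `&` V2); [exact: openI|split; [rewrite subsetI|exact: setISS]].
have [_ [C [cC [V oV [KV VC]]] <-] CW] : exists2 C, [set q C | C in D] C & C `<=` W.
  apply: compact_directed_bigcap => //.
  - have [V [C [oV cC KV VC _]]] := compact_interposition lX rX cK openT (@subsetT _ K).
    by exists (q C), C => //; split => //; exists V.
  - move=> _ _ [C1 DC1 <-] [C2 DC2 <-]; exists (q (C1 `&` C2)).
      by exists (C1 `&` C2) => //; exact: DI.
    have [cC1 _] := DC1; have [cC2 _] := DC2; have [cC _] := DI _ _ DC1 DC2.
    by rewrite subsetI; split; apply: dit_le => //; try right.
  - by move=> _ [C [cC _] <-]; exact: dit_compact.
  - apply: subset_trans KW => y qy; rewrite (dit_outer dq cK) => U [oU KU].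
    have [V [C [oV cC KV VC CU]]] := compact_interposition lX rX cK oU KU.
    have : q C y by apply: qy; exists C => //; split => //; exists V.
    by apply: dit_le => //; [right|left].
exists V; split => //; apply: subset_trans CW.
by apply: dit_le => //; [left|right].
Qed.

End ImageTransformations.

(** * The adjoint preserves (deficient) topological measures and series *)

Section Adjoint.
Context {R : realType} {X Y : topologicalType}.
Hypotheses (hX : hausdorff_space X) (hY : hausdorff_space Y).
Hypotheses (lX : locally_compact [set: X]) (rX : regular_space X).
Local Open Scope ereal_scope.
Implicit Types (q : set X -> set Y) (nu : set Y -> \bar R) (A B : set X).

Lemma adjointE q nu A : open_compact A -> adjoint q nu A = nu (q A).
Proof. by move=> oA; rewrite /adjoint; case: asboolP. Qed.

Lemma dit_open_closed q A : d_image_transformation q -> open_compact A ->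
  open_closed (q A).
Proof.
move=> dq [oA|cA]; first by left; exact: (dit_open dq).
by right; exact: (compact_closed hY (dit_compact dq cA)).
Qed.

(** A compact subset C of q(U) need not be the image of a compact set. It is covered by the open
    sets q(V) with V inside a compact subset L of U; directedness gives one such V, and then C lies
    in q(L). *)
Lemma adjoint_inner q nu : d_image_transformation q ->
  deficient_topological_measure nu -> inner_compact (adjoint q nu).
Proof.
move=> dq dnu U oU; rewrite adjointE; last by left.
apply/eqP; rewrite eq_le; apply/andP; split; last first.
  apply: ge_ereal_sup => _ [K [cK KU] <-]; rewrite adjointE; last by right.
  apply: dtm_le => //; try (apply: dit_open_closed => //; by [left|right]).
  by apply: dit_le => //; [right|left].
rewrite (dtm_inner dnu); last exact: (dit_open dq).
apply: ge_ereal_sup => _ [C [cC CqU] <-].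
have [_ [V [oV [L [cL VL LU]]] <-] CV] : exists2 W, [set q V | V in [set V |
    open V /\ exists L, [/\ compact L, V `<=` L & L `<=` U]]] W & C `<=` W.
  apply: compact_directed_cover => //.
  - exists (q set0), set0 => //; split; first exact: open0.
    by exists set0; split => //; exact: compact0.
  - move=> _ _ [V1 [oV1 [L1 [cL1 VL1 LU1]]] <-] [V2 [oV2 [L2 [cL2 VL2 LU2]]] <-].
    exists (q (V1 `|` V2)).
      exists (V1 `|` V2) => //; split; first exact: openU.
      exists (L1 `|` L2); split; [exact: compactU|exact: setUSS|].
      by rewrite subUset.
    rewrite subUset; split; apply: dit_le => //; try (by left);
      try (left; exact: openU).
  - by move=> _ [V [oV _] <-]; exact: (dit_open dq).
  - apply: (subset_trans CqU); rewrite (dit_inner dq oU) => y [K [cK KU] qy].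
    have [V [L [oV cL KV VL LU]]] := compact_interposition lX rX cK oU KU.
    exists (q V); first by exists V => //; split => //; exists L.
    by move: qy; apply: dit_le => //; [right|left].
apply: (@le_trans _ _ (nu (q L))).
  apply: dtm_le => //; first by right; exact: compact_closed.
    by apply: dit_open_closed => //; right.
  by apply: (subset_trans CV); apply: dit_le => //; [left|right].
by apply: ereal_sup_ubound; exists L; [split|rewrite adjointE//; right].
Qed.

(** For F neither open nor compact the formula is the definition of [adjoint], and an open F is its
    own best open superset. For compact F, an open W around q(F) is pulled back to X by
    [dit_compact_sub]. *)
Lemma adjoint_outer q nu : d_image_transformation q ->
  deficient_topological_measure nu -> outer_open_on closed (adjoint q nu).
Proof.
move=> dq dnu F clF.
have -> : ereal_inf [set adjoint q nu U | U in [set U | open U /\ F `<=` U]] =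
    ereal_inf [set nu (q U) | U in [set U | open U /\ F `<=` U]].
  by congr ereal_inf; apply: eq_imagel => U [oU _]; rewrite adjointE//; left.
have [ocF|nocF] := pselect (open_compact F); last first.
  by rewrite /adjoint; case: asboolP.
rewrite adjointE//; apply/eqP; rewrite eq_le; apply/andP; split.
  apply: le_ereal_inf_tmp => _ [U [oU FU] <-]; apply: dtm_le => //.
  - exact: dit_open_closed.
  - by left; exact: (dit_open dq).
  - by apply: dit_le => //; left.
case: ocF => [oF|cF]; first by apply: ereal_inf_lbound; exists F => //; split.
rewrite (dtm_outer dnu (compact_closed hY (dit_compact dq cF))).
apply: le_ereal_inf_tmp => _ [W [oW FW] <-].
have [U [oU FU UW]] := dit_compact_sub hX hY lX rX dq cF oW FW.
apply: (@le_trans _ _ (nu (q U))); first by apply: ereal_inf_lbound; exists U.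
by apply: dtm_le => //; left => //; exact: (dit_open dq).
Qed.

Lemma adjoint_ge0 q nu A : d_image_transformation q ->
  deficient_topological_measure nu -> 0 <= adjoint q nu A.
Proof.
move=> dq dnu; rewrite /adjoint; case: asboolP => oA.
  by apply: (dtm_ge0 dnu); exact: dit_open_closed.
apply: le_ereal_inf_tmp => _ [U [oU _] <-]; apply: (dtm_ge0 dnu).
by left; exact: (dit_open dq).
Qed.

Lemma adjoint_setT_le q nu : d_image_transformation q ->
  deficient_topological_measure nu -> adjoint q nu [set: X] <= nu [set: Y].
Proof.
move=> dq dnu; rewrite adjointE; last by left; exact: openT.
apply: dtm_le => //; last by left; exact: openT.
by left; apply: (dit_open dq); exact: openT.
Qed.

Lemma adjoint_neqy q nu : d_image_transformation q ->
  deficient_topological_measure nu -> exists2 A, open_closed A & adjoint q nu A <> +oo.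
Proof.
move=> dq dnu; exists set0; first by left; exact: open0.
rewrite adjointE; last by left; exact: open0.
by rewrite (dit_set0 dq) (dtm_set0 dnu).
Qed.

Lemma adjoint_dtm q nu : d_image_transformation q -> DTM R Y nu ->
  DTM R X (adjoint q nu).
Proof.
move=> dq [dnu nuY]; split; last by apply: le_lt_trans nuY; exact: adjoint_setT_le.
split.
- by move=> A _; exact: adjoint_ge0.
- exact: adjoint_neqy.
- move=> A B cA cB AB; have [dAB qAB] := dit_disjoint dq cA cB AB.
  rewrite !adjointE; try by right; [].
    by rewrite qAB; apply: (dtm_add dnu) => //; exact: (dit_compact dq).
  by right; exact: compactU.
- exact: adjoint_inner.
- exact: adjoint_outer.
Qed.

Lemma adjoint_tm q nu : image_transformation q -> TM R Y nu ->
  TM R X (adjoint q nu).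
Proof.
move=> iq tnu; have dq := image_transformation_d iq.
have [dnu _] := TM_DTM tnu; have [_ ?] := adjoint_dtm dq (TM_DTM tnu).
have qoc A : open_compact A -> open_compact (q A).
  by case=> [oA|cA]; [left; exact: (dit_open dq)|right; exact: (dit_compact dq)].
split => //; split.
- by move=> A _; exact: adjoint_ge0.
- exact: adjoint_neqy.
- move=> A B oA oB oAB AB; have [dAB qAB] := it_disjoint iq oA oB oAB AB.
  rewrite !adjointE// qAB; apply: (tm_add tnu.1) => //; try exact: qoc.
  by rewrite -qAB; exact: qoc.
- exact: adjoint_inner.
- exact: adjoint_outer.
Qed.

(** On open or compact sets the identity holds term by term. Elsewhere [adjoint] is an infimum, and
    exchanging it with the series is where the summable total masses enter. *)
Lemma adjoint_series q (c : R^nat) (nu : nat -> set Y -> \bar R) A :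
  d_image_transformation q -> (forall i, 0 <= c i)%R -> (forall i, DTM R Y (nu i)) ->
  \sum_(0 <= i <oo) (c i)%:E * nu i [set: Y] < +oo ->
  adjoint q (fun C => \sum_(0 <= i <oo) (c i)%:E * nu i C) A =
  \sum_(0 <= i <oo) (c i)%:E * adjoint q (nu i) A.
Proof.
move=> dq c0 nud cnu; have [oA|noA] := pselect (open_compact A).
  by rewrite adjointE//; apply: eq_eseriesr => i _; rewrite adjointE.
have adT : \sum_(0 <= i <oo) (c i)%:E * adjoint q (nu i) [set: X] < +oo.
  apply: le_lt_trans cnu; apply: lee_nneseries => [i _ _|i _].
    by rewrite mule_ge0 ?lee_fin//; exact: (adjoint_ge0 _ dq (nud i).1).
  by rewrite lee_wpmul2l ?lee_fin//; exact: (adjoint_setT_le dq (nud i).1).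
have eqinf (mu : set Y -> \bar R) :
    ereal_inf [set mu (q U) | U in [set U | open U /\ A `<=` U]] =
    ereal_inf [set adjoint q mu U | U in [set U | open U /\ A `<=` U]].
  by congr ereal_inf; apply: eq_imagel => U [oU _]; rewrite adjointE//; left.
rewrite {1}/adjoint; case: asboolP => // _.
transitivity (ereal_inf [set \sum_(0 <= i <oo) (c i)%:E * adjoint q (nu i) U |
    U in [set U | open U /\ A `<=` U]]).
  congr ereal_inf; apply: eq_imagel => U [oU _].
  by apply: eq_eseriesr => i _; rewrite adjointE//; left.
rewrite -(series_ereal_inf c0 (fun i => adjoint_dtm dq (nud i)) adT).
apply: eq_eseriesr => i _.
by rewrite -eqinf /adjoint; case: asboolP.
Qed.

End Adjoint.

(** * Quasi-homomorphisms and their level sets *)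

Notation superlevel f t := (f @^-1` [set s | (t < s)%R]).

Lemma open_superlevel (R : realType) (X : topologicalType) (f : X -> R) t :
  continuous f -> open (superlevel f t).
Proof. by move=> cf; apply: open_comp => [x _|]; [exact: cf|exact: open_gt]. Qed.

Lemma superlevel_le (R : realType) (X : Type) (f : X -> R) (s t : R) : s <= t ->
  superlevel f t `<=` superlevel f s.
Proof. by move=> st x /=; exact: le_lt_trans. Qed.

Lemma continuous_levels (R : realType) (X : topologicalType) (f : X -> R) :
  (forall t, open [set x | t < f x]) -> (forall t, open [set x | f x < t]) ->
  continuous f.
Proof.
move=> fg fl x; apply/cvgrPdist_lt => e e0.
have n1 : nbhs x [set y | f x - e < f y].
  by apply: open_nbhs_nbhs; split; [exact: fg|rewrite /= ltrBlDr ltrDl].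
have n2 : nbhs x [set y | f y < f x + e].
  by apply: open_nbhs_nbhs; split; [exact: fl|rewrite /= ltrDl].
apply: filterS2 n1 n2 => y /= h1 h2.
by rewrite ltr_distlC; apply/andP; split; lra.
Qed.

Lemma C0_bounded (R : realType) (X : topologicalType) (f : X -> R) : C0 R X f ->
  exists2 c : R, 0 <= c & forall x, `|f x| <= c.
Proof.
move=> [cf fc]; pose K := [set x | 1 <= `|f x|].
have cK : compact (f @` K).
  by apply: continuous_compact; [exact: continuous_subspaceT|exact: fc].
have [M [Mr MK]] := compact_bounded cK.
(* Off the compact set [K] the bound is 1; on it, [compact_bounded] provides only constants strictly
   above [M]. *)
exists (Num.max 1 (M + 1)); first by rewrite le_max ler01.
move=> x; have [fx|fx] := leP 1 `|f x|; last by rewrite le_max (ltW fx).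
by rewrite le_max (MK (M + 1)) ?orbT ?ltrDl//; exists x.
Qed.

Section QuasiHomomorphisms.
Context {R : realType} {X Y : topologicalType}.
Hypotheses (hX : hausdorff_space X).
Implicit Types (q : set X -> set Y) (f : X -> R) (y : Y).

(** A compact subset of {f > t} lies in {f > s} for some s > t. Consequently the half-line of levels
    s with y in q({f > s}) does not contain its right end point. *)
Lemma dit_superlevel_bigcup q f t : d_image_transformation q -> continuous f ->
  q (superlevel f t) = \bigcup_(s in [set s | t < s]) q (superlevel f s).
Proof.
move=> dq cf; apply/seteqP; split; last first.
  move=> y [s /= ts]; apply: dit_le => //; try by left; exact: open_superlevel.
  exact/superlevel_le/ltW.
rewrite (dit_inner dq); last exact: open_superlevel.
move=> y [K [cK Kt] qy].
have [_ [s /= ts <-] Ks] : exists2 U,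
    [set superlevel f s | s in [set s | t < s]] U & K `<=` U.
  apply: compact_directed_cover => //.
  - by exists (superlevel f (t + 1)), (t + 1) => //=; rewrite ltrDl.
  - move=> _ _ [s1 /= ts1 <-] [s2 /= ts2 <-].
    exists (superlevel f (Num.min s1 s2)).
      by exists (Num.min s1 s2) => //=; rewrite lt_min ts1.
    by rewrite subUset; split; apply: superlevel_le; rewrite ge_min lexx ?orbT.
  - by move=> _ [s _ <-]; exact: open_superlevel.
  - move=> x /Kt /= tx; exists (superlevel f ((t + f x) / 2)) => /=; last lra.
    by exists ((t + f x) / 2) => //=; lra.
exists s => //; move: qy; apply: dit_le => //; first by right.
by left; exact: open_superlevel.
Qed.

Lemma bounds_xgetP f (c : R) : (forall x, `|f x| <= c) ->
  let ab := xget (0, 0) [set ab : R * R | forall x, ab.1 <= f x <= ab.2] in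
  forall x, ab.1 <= f x <= ab.2.
Proof.
move=> fc ab; rewrite /ab; case: xgetP => //= h.
by exfalso; apply: (h (- c, c)) => x /=; rewrite -ler_norml.
Qed.

Lemma quasi_hom_notin q f y : d_image_transformation q -> continuous f ->
  ~ q [set: X] y -> quasi_hom q f y = 0.
Proof.
move=> dq cf nqy; have oT : open_compact [set: X] by left; exact: openT.
rewrite /quasi_hom /qint adjointE// {2}/point_mass indicE memNset// mule0 adde0.
rewrite integral0_eq// => t _; rewrite adjointE; last by left; exact: open_superlevel.
rewrite /point_mass indicE memNset// => qy; apply: nqy; move: qy.
by apply: (dit_sub_setT dq); left; exact: open_superlevel.
Qed.

(* [s |-> (q^* delta_y){f > s}] is the indicator of a half-line, whose right
   end point is [quasi_hom q f y]. *)
Lemma quasi_homP q f y t : d_image_transformation q -> C0 R X f ->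
  q [set: X] y -> (t < quasi_hom q f y) <-> q (superlevel f t) y.
Proof.
move=> dq f0 qy; have cf := f0.1.
have oT : open_compact [set: X] by left; exact: openT.
have osl s : open_compact (superlevel f s) by left; exact: open_superlevel.
have [x0] : [set: X] !=set0.
  by apply/set0P/negP => /eqP X0; move: qy; rewrite X0 (dit_set0 dq).
have [c _ fc] := C0_bounded f0.
rewrite /quasi_hom /qint; have := bounds_xgetP fc.
set ab := xget _ _ => /=; case: ab => a b /= fab _.
have ab : a <= b by have /andP[] := fab x0; exact: le_trans.
have qb s : q (superlevel f s) y -> s < b.
  move=> qs; rewrite ltNge; apply/negP => bs.
  have s0 : superlevel f s = set0.
    apply/seteqP; split => // x /=; apply/negP; rewrite -leNgt.
    by have /andP[_ /le_trans->] := fab x.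
  by move: qs; rewrite s0 (dit_set0 dq).
(* Including [a] keeps [S] non-empty and [sup S] at least [a], also when no level s >= a has y in
   q({f > s}). *)
pose S := [set s | s = a \/ a <= s /\ q (superlevel f s) y].
have supS : has_sup S.
  split; first by exists a; left.
  by exists b => s [->//|[_ /qb/ltW]].
have Pa s : a <= s -> s < sup S <-> q (superlevel f s) y.
  move=> sa; split.
    move=> /(sup_gt supS.1)[r [-> /lt_le_trans /(_ sa)|]]; first by rewrite ltxx.
    move=> [_ qr] sr; move: qr; apply: dit_le => //; exact/superlevel_le/ltW.
  (* A level r strictly above s is what makes s < sup S strict. *)
  rewrite (dit_superlevel_bigcup _ dq cf) => -[r /= sr qr].
  apply: (lt_le_trans sr); apply: ub_le_sup; first exact: supS.2.
  by right; split => //; rewrite (le_trans sa)// ltW.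
have aS : a <= sup S by apply: ub_le_sup; [exact: supS.2|left].
have Sb : sup S <= b.
  by apply: ge_sup; [exact: supS.1|move=> s [->//|[_ /qb/ltW]]].
have -> : fine (\int[lebesgue_measure]_(s in `[a, b])
      adjoint q (point_mass y) (superlevel f s) +
      a%:E * adjoint q (point_mass y) [set: X])%E = sup S.
  (* Since y lies in q(X), the mass term equals [a] and cancels the [- a] in the length of [a, sup
     S). *)
  rewrite adjointE// {2}/point_mass indicE mem_set// mule1.
  rewrite (_ : integral _ _ _ = (sup S - a)%:E); first by rewrite /= subrK.
  transitivity (\int[lebesgue_measure]_(s in `[a, b]) (\1_(`[a, sup S[%classic) s)%:E)%E.
    apply: eq_integral => s; rewrite inE/= in_itv/= => /andP[sa sb].
    rewrite adjointE// /point_mass !indicE; congr ((_ _)%:R%:E).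
    apply/idP/idP; rewrite !inE/= in_itv/= sa/=; first by move/(Pa s sa).
    by move/(Pa s sa).
  rewrite integral_indic//= setIidl; last first.
    move=> s /=; rewrite !in_itv/= => /andP[-> /ltW]/= sS.
    exact: le_trans Sb.
  rewrite lebesgue_measure_itv/= lte_fin.
  case: ifPn => // /negbTE aS'; have -> : sup S = a.
    by apply/eqP; rewrite eq_le aS andbT leNgt aS'.
  by rewrite subrr.
have [ta|/Pa//] := ltP t a.
split=> _; last exact: lt_le_trans aS.
suff -> : superlevel f t = setT by [].
apply/seteqP; split => // x _ /=.
by have /andP[+ _] := fab x; exact: lt_le_trans.
Qed.

Lemma quasi_hom_norm_le q f c y : d_image_transformation q -> C0 R X f ->
  0 <= c -> (forall x, `|f x| <= c) -> `|quasi_hom q f y| <= c.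
Proof.
move=> dq f0 c0 fc; have [qy|nqy] := pselect (q setT y); last first.
  by rewrite quasi_hom_notin ?normr0//; exact: f0.1.
rewrite ler_norml; apply/andP; split; last first.
  rewrite leNgt; apply/negP => /(quasi_homP _ dq f0 qy).
  rewrite (_ : superlevel f c = set0) ?(dit_set0 dq)//.
  apply/seteqP; split => // x /=; apply/negP; rewrite -leNgt.
  by rewrite (le_trans (ler_norm _))// fc.
apply/ler_addgt0Pr => e e0; rewrite -lerBlDr; apply/ltW/(quasi_homP _ dq f0 qy).
rewrite (_ : superlevel f _ = setT)//; apply/seteqP; split => // x _ /=.
have := fc x; rewrite ler_norml => /andP[h _]; lra.
Qed.

Lemma quasi_hom_ge0 q f y : d_image_transformation q -> C0pos R X f ->
  0 <= quasi_hom q f y.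
Proof.
move=> dq [f0 fge0]; have [qy|nqy] := pselect (q setT y); last first.
  by rewrite quasi_hom_notin//; exact: f0.1.
apply/ler_addgt0Pr => e e0; rewrite -lerBlDr; apply/ltW/(quasi_homP _ dq f0 qy).
rewrite (_ : superlevel f _ = setT)//; apply/seteqP; split => // x _ /=.
by have := fge0 x; lra.
Qed.

Lemma quasi_hom_superlevel q f t : d_image_transformation q -> C0 R X f ->
  0 <= t -> superlevel (quasi_hom q f) t = q (superlevel f t).
Proof.
move=> dq f0 t0; have cf := f0.1; apply/seteqP; split => y /=.
  have [qy|nqy] := pselect (q setT y); first by move/(quasi_homP _ dq f0 qy).
  by rewrite quasi_hom_notin// ltNge t0.
move=> qty; apply/(quasi_homP _ dq f0) => //.
by apply: (dit_sub_setT dq) qty; left; exact: open_superlevel.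
Qed.

Lemma quasi_hom_superlevel_neg q f t : d_image_transformation q -> C0 R X f ->
  t < 0 ->
  superlevel (quasi_hom q f) t = q (superlevel f t) `|` ~` q [set: X].
Proof.
move=> dq f0 t0; have cf := f0.1; apply/seteqP; split => y /=.
  have [qy|nqy] := pselect (q setT y); last by right.
  by move/(quasi_homP _ dq f0 qy); left.
case=> [qty|nqy]; last by rewrite quasi_hom_notin.
apply/(quasi_homP _ dq f0) => //.
by apply: (dit_sub_setT dq) qty; left; exact: open_superlevel.
Qed.

Lemma C0_compact_ge f t : C0 R X f -> 0 < t -> compact [set x | t <= f x].
Proof.
move=> [cf fc] t0; apply: subclosed_compact (fc _ t0) _.
  by apply: (@preimage_closed _ _ f [set s | t <= s]) => //; exact: closed_ge.
by move=> x /= tx; apply: (le_trans tx); exact: ler_norm.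
Qed.

Lemma C0_opp f : C0 R X f -> C0 R X (fun x => - f x).
Proof.
move=> [cf fc]; split; first by move=> x; apply: cvgN; exact: cf.
by move=> e /fc; congr compact; apply/seteqP; split => x /=; rewrite normrN.
Qed.

Lemma C0_compact_le f t : C0 R X f -> t < 0 -> compact [set x | f x <= t].
Proof.
move=> /C0_opp f0 t0; have := C0_compact_ge f0 (t := - t); rewrite oppr_gt0.
by move=> /(_ t0); congr compact; apply/seteqP; split => x /=; rewrite lerN2.
Qed.

(** For t > 0 the set {f >= t} is compact, so its image is determined by open supersets U, and each
    U already contains {f >= s} for some s strictly between 0 and t. This yields compactness of the
    upper level sets of theta f. *)
Lemma quasi_hom_ge q f t : d_image_transformation q -> C0 R X f -> 0 < t ->
  [set y | t <= quasi_hom q f y] = q [set x | t <= f x].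
Proof.
move=> dq f0 t0; have cf := f0.1; have cft := C0_compact_ge f0 t0.
apply/seteqP; split => y /=; last first.
  move=> qty; apply/ler_addgt0Pr => e e0; rewrite -lerBlDr; apply/ltW.
  apply/(quasi_homP _ dq f0).
    by apply: (dit_sub_setT dq) qty; right.
  move: qty; apply: (dit_le dq); first by right.
    by left; exact: open_superlevel.
  by move=> x /=; lra.
move=> tqy; rewrite (dit_outer dq cft) => U [oU tU].
have [_ [s /= /andP[s0 st] <-] sU] : exists2 C, [set [set x | s <= f x] |
    s in [set s | 0 < s < t]] C & C `<=` U.
  apply: compact_directed_bigcap => //.
  - by exists [set x | t / 2 <= f x], (t / 2) => //=; lra.
  - move=> _ _ [s1 /= /andP[s10 s1t] <-] [s2 /= /andP[s20 s2t] <-].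
    exists [set x | Num.max s1 s2 <= f x].
      by exists (Num.max s1 s2) => //=; rewrite lt_max s10/= gt_max s1t.
    by move=> x /=; rewrite ge_max => /andP[].
  - by move=> _ [s /= /andP[s0 _] <-]; exact: C0_compact_ge.
  - apply: subset_trans tU => x /= h; apply/ler_addgt0Pr => e e0.
    (* The level [t - e] is admissible only if it is positive; otherwise [t / 2] suffices. *)
    have [et|te] := ltP e t.
      have /= := h [set x | t - e <= f x]; rewrite -lerBlDr; apply.
      by exists (t - e) => //=; lra.
    have /= := h [set x | t / 2 <= f x] => h2.
    have : t / 2 <= f x by apply: h2; exists (t / 2) => //=; lra.
    by lra.
have qs : q (superlevel f s) y.
  by rewrite -quasi_hom_superlevel// ?ltW//=; exact: lt_le_trans tqy.
move: qs; apply: (dit_le dq).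
- by left; exact: open_superlevel.
- by left.
- by apply: subset_trans sU => x /= /ltW.
Qed.

(** At the levels that matter, {theta f > t} is the image of an open set and {theta f < t} is the
    complement of the compact set q({f >= t}). *)
Lemma quasi_hom_C0pos q f : hausdorff_space Y -> d_image_transformation q ->
  C0pos R X f -> C0pos R Y (quasi_hom q f).
Proof.
move=> hY dq f0p; have [f0 f_ge0] := f0p; have cf := f0.1.
have q_ge0 y : 0 <= quasi_hom q f y by exact: quasi_hom_ge0.
have cge t : 0 < t -> compact [set y | t <= quasi_hom q f y].
  by move=> t0; rewrite quasi_hom_ge//; apply: (dit_compact dq); exact: C0_compact_ge.
split=> //; split; last first.
  move=> e /cge; congr compact; apply/seteqP; split => y /=;
    by rewrite ger0_norm.
apply: continuous_levels => t.
  have [t0|t0] := leP 0 t.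
    have := quasi_hom_superlevel dq f0 t0; rewrite /preimage/= => ->.
    by apply: (dit_open dq); exact: open_superlevel.
  rewrite (_ : [set _ | _] = setT); first exact: openT.
  by apply/seteqP; split => // y _ /=; exact: lt_le_trans (q_ge0 y).
have [t0|t0] := ltP 0 t.
  rewrite (_ : [set _ | _] = ~` [set y | t <= quasi_hom q f y]).
    exact: (closed_openC (compact_closed hY (cge _ t0))).
  by apply/seteqP; split => y /=; rewrite ltNge => /negP.
rewrite (_ : [set _ | _] = set0); first exact: open0.
by apply/seteqP; split => // y /=; rewrite ltNge (le_trans t0).
Qed.

(* For [t < 0] the compact set {f <= t} and the open set {f > t} partition X, a
   decomposition that only an image transformation has to respect. *)
Lemma quasi_hom_le q f t : image_transformation q -> C0 R X f -> t < 0 ->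
  [set y | quasi_hom q f y <= t] = q [set x | f x <= t].
Proof.
move=> iq f0 t0; have dq := image_transformation_d iq; have cf := f0.1.
have cft := C0_compact_le f0 t0.
have fT : [set x | f x <= t] `|` superlevel f t = setT.
  by apply/seteqP; split => // x _ /=; case: (leP (f x) t) => h; [left|right].
have [||||qd qT] := it_disjoint iq (A := [set x | f x <= t]) (B := superlevel f t).
- by right.
- by left; exact: open_superlevel.
- by rewrite fT; left; exact: openT.
- by apply/disj_setPS => x /= [/le_lt_trans h] /h; rewrite ltxx.
rewrite fT in qT; apply/seteqP; split => y /=.
  move=> qyt; have [qy|nqy] := pselect (q setT y); last first.
    by move: qyt; rewrite quasi_hom_notin// leNgt t0.
  move: (qy); rewrite qT => -[//|/(quasi_homP _ dq f0 qy)].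
  by rewrite ltNge qyt.
move=> qty; rewrite leNgt; apply/negP => /(quasi_homP _ dq f0) h.
move/disj_set2P: qd; apply/seteqP => -[+ _] => /(_ y); apply; split => //; apply: h.
by rewrite qT; left.
Qed.

(** Two kinds of level sets are new compared with nonnegative f. For t < 0, {theta f > t} is the
    complement of the compact set q({f <= t}). For t <= 0, {theta f < t} is the open set q({f < t}),
    by writing {f < t} as a superlevel set of -f. *)
Lemma quasi_hom_C0 q f : hausdorff_space Y -> image_transformation q ->
  C0 R X f -> C0 R Y (quasi_hom q f).
Proof.
move=> hY iq f0; have dq := image_transformation_d iq; have cf := f0.1.
have cge t : 0 < t -> compact [set y | t <= quasi_hom q f y].
  by move=> t0; rewrite quasi_hom_ge//; apply: (dit_compact dq); exact: C0_compact_ge.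
have cle t : t < 0 -> compact [set y | quasi_hom q f y <= t].
  by move=> t0; rewrite quasi_hom_le//; apply: (dit_compact dq); exact: C0_compact_le.
split; last first.
  move=> e e0; have := compactU (cge _ e0) (cle (- e) _).
  rewrite oppr_lt0 => /(_ e0); congr compact; apply/seteqP; split => y /=.
    by rewrite ler_normr => -[->//|]; rewrite lerNr => ->; rewrite orbT.
  by rewrite ler_normr => /orP[]; [left|rewrite lerNr; right].
apply: continuous_levels => t.
  have [t0|t0] := leP 0 t.
    have := quasi_hom_superlevel dq f0 t0; rewrite /preimage/= => ->.
    by apply: (dit_open dq); exact: open_superlevel.
  rewrite (_ : [set _ | _] = ~` [set y | quasi_hom q f y <= t]).
    exact: (closed_openC (compact_closed hY (cle _ t0))).
  by apply/seteqP; split => y /=; rewrite ltNge => /negP.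
have [t0|t0] := ltP 0 t.
  rewrite (_ : [set _ | _] = ~` [set y | t <= quasi_hom q f y]).
    exact: (closed_openC (compact_closed hY (cge _ t0))).
  by apply/seteqP; split => y /=; rewrite ltNge => /negP.
have cNf : continuous (fun x => - f x) := (C0_opp f0).1.
rewrite (_ : [set _ | _] = q (superlevel (fun x => - f x) (- t))).
  by apply: (dit_open dq); exact: open_superlevel.
rewrite (dit_superlevel_bigcup _ dq cNf); apply/seteqP; split => y /=.
  (* A level strictly between theta f (y) and t; it is negated because the union runs over
     superlevel sets of -f. *)
  move=> qyt; pose s := (quasi_hom q f y + t) / 2.
  exists (- s); first by rewrite /= /s; lra.
  have : [set z | quasi_hom q f z <= quasi_hom q f y] y by rewrite /=.
  rewrite quasi_hom_le//; last lra.
  apply: (dit_le dq).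
  - by right; apply: C0_compact_le => //; lra.
  - by left; exact: open_superlevel.
  - by move=> x /=; rewrite /s; lra.
move=> [s /= ts qs]; apply: (@le_lt_trans _ _ (- s)); last lra.
have : q [set x | f x <= - s] y.
  move: qs; apply: (dit_le dq).
  - by left; exact: open_superlevel.
  - by right; apply: C0_compact_le => //; lra.
  - by move=> x /=; lra.
by rewrite -quasi_hom_le//; lra.
Qed.

End QuasiHomomorphisms.

(** * Real series: comparison and tails *)

Section RealSeries.
Context {R : realType}.
Implicit Types (u v : R^nat).

Lemma cvg_series_fine u : (forall i, 0 <= u i) ->
  (\sum_(0 <= i <oo) (u i)%:E < +oo)%E ->
  series u @ \oo --> fine (\sum_(0 <= i <oo) (u i)%:E)%E.
Proof.
move=> u0 us.
have ufin : (\sum_(0 <= i <oo) (u i)%:E)%E \is a fin_num.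
  by rewrite ge0_fin_numE// nneseries_ge0// => i _ _; rewrite lee_fin.
have cu : (fun n => \sum_(0 <= i < n) (u i)%:E)%E @ \oo -->
    (fine (\sum_(0 <= i <oo) (u i)%:E))%:E%E.
  by rewrite fineK//; apply: is_cvg_nneseries => i _ _; rewrite lee_fin.
rewrite (_ : series u = fine \o (fun n => \sum_(0 <= i < n) (u i)%:E)%E).
  exact: fine_cvg cu.
by apply/funext => n /=; rewrite sumEFin.
Qed.

Lemma nneseries_cvg u : (forall i, 0 <= u i) -> cvgn (series u) ->
  (\sum_(0 <= i <oo) (u i)%:E = (limn (series u))%:E)%E.
Proof.
move=> u0 cu; apply/cvg_lim => //.
rewrite (_ : (fun n => _) = EFin \o series u); last first.
  by apply/funext => n /=; rewrite sumEFin.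
by apply: cvg_comp cu _.
Qed.

Lemma cvg_seriesMr u (k l : R) : series u @ \oo --> l ->
  series (fun i => u i * k) @ \oo --> l * k.
Proof.
move=> ul; rewrite (_ : series _ = (fun n => series u n * k)).
  by apply: cvgMr_tmp.
by apply/funext => n; rewrite !seriesEnat/= mulr_suml.
Qed.

Lemma is_cvg_seriesMr u (k : R) : cvgn (series u) ->
  cvgn (series (fun i => u i * k)).
Proof. by move=> cu; apply/cvg_ex; eexists; exact: cvg_seriesMr cu. Qed.

(** Compare the blocks from n to m and let m tend to infinity. With n = 0 this bounds the sum
    itself. *)
Lemma series_tail_le u v (l V : R) n : (forall i, `|u i| <= v i) ->
  series u @ \oo --> l -> series v @ \oo --> V ->
  `|l - series u n| <= V - series v n.
Proof.
move=> uv cu cv.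
have c1 : (fun m => `|series u m - series u n|) @ \oo --> `|l - series u n|.
  by apply: cvg_norm; apply: cvgB => //; exact: cvg_cst.
have c2 : (fun m => series v m - series v n) @ \oo --> V - series v n.
  by apply: cvgB => //; exact: cvg_cst.
rewrite -(cvg_lim _ c1)// -(cvg_lim _ c2)//; apply: ler_lim.
- by apply/cvg_ex; eexists; exact: c1.
- by apply/cvg_ex; eexists; exact: c2.
exists n => // m /= nm; rewrite !sub_series_geq//.
by apply: (le_trans (ler_norm_sum _ _ _)); apply: ler_sum.
Qed.

Lemma series_abs_cvg u v : (forall i, `|u i| <= v i) -> cvgn (series v) ->
  cvgn (series u).
Proof.
move=> uv cv; apply: normed_cvg; apply: series_le_cvg cv => //.
  by move=> n /=.
by move=> n; exact: le_trans (uv n).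
Qed.

End RealSeries.

(** * The quasi-integral through distribution functions *)

Section QuasiIntegral.
Context {R : realType} {X : topologicalType}.
Implicit Types (nu : set X -> \bar R) (f : X -> R) (a b c t : R).

(** On [a', a) the integrand is m, which contributes m times a - a' and makes up for replacing a by
    a' in the mass term; beyond b it vanishes. Independence of [qint] from the chosen interval rests
    on this. *)
Lemma integral_itv_widen (G : R -> R) (m a b a' b' : R) :
  nonincreasing_fun G -> (forall t, 0 <= G t) ->
  a' <= a -> a <= b -> b <= b' ->
  (forall t, t < a -> G t = m) -> (forall t, b <= t -> G t = 0) ->
  (\int[lebesgue_measure]_(t in `[a', b']) (G t)%:E + a'%:E * m%:E =
   \int[lebesgue_measure]_(t in `[a, b]) (G t)%:E + a%:E * m%:E)%E.
Proof.
move=> Gni G0 aa ab bb Gm Gz.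
have mG (D : set R) : measurable D -> measurable_fun D (fun t : R => (G t)%:E).
  by move=> mD; apply/measurable_EFinP; exact: nonincreasing_measurable.
have -> : `[a', b']%classic = (`[a', a[ `|` (`[a, b] `|` `]b, b']))%classic.
  rewrite -itv_bndbnd_setU ?bnd_simp//.
  by rewrite -itv_bndbnd_setU ?bnd_simp// (le_trans ab).
rewrite ge0_integral_setU//=; last 4 first.
- exact: measurableU.
- by apply: mG; apply: measurableU => //; exact: measurableU.
- by move=> t _; rewrite lee_fin.
- apply/disj_setPS => t [/=]; rewrite !in_itv/= => /andP[_ ta] [/andP[at_ _]|].
    by move: (lt_le_trans ta at_); rewrite ltxx.
  by move=> /andP[bt _]; have := lt_trans (lt_le_trans ta ab) bt; rewrite ltxx.
rewrite ge0_integral_setU//=; last 3 first.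
- by apply: mG; exact: measurableU.
- by move=> t _; rewrite lee_fin.
- apply/disj_setPS => t [/=]; rewrite !in_itv/= => /andP[_ tb] /andP[bt _].
  by move: (le_lt_trans tb bt); rewrite ltxx.
rewrite [X in (_ + (_ + X) + _)%E]integral0_eq; last first.
  by move=> t; rewrite /= in_itv/= => /andP[/ltW/Gz-> _].
rewrite adde0 [X in (X + _ + _)%E](_ : _ = (m * (a - a'))%:E); last first.
  transitivity (\int[lebesgue_measure]_(t in `[a', a[) (cst m%:E t))%E.
    by apply: eq_integral => t; rewrite inE/= in_itv/= => /andP[_ /Gm->].
  rewrite integral_cst//= lebesgue_measure_itv/= lte_fin EFinM.
  have := aa; rewrite le_eqVlt => /predU1P[->|->//].
  by rewrite ltxx subrr !mule0.
rewrite addeAC addeC; congr (_ + _)%E; rewrite -!EFinM -EFinD; congr EFin; ring.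
Qed.

Lemma superlevel_setT f a t : (forall x, a <= f x) -> t < a -> superlevel f t = setT.
Proof.
by move=> fa ta; apply/seteqP; split => // x _ /=; exact: lt_le_trans (fa x).
Qed.

Lemma superlevel_set0 f b t : (forall x, f x <= b) -> b <= t -> superlevel f t = set0.
Proof.
move=> fb bt; apply/seteqP; split => // x /=; apply/negP; rewrite -leNgt.
exact: le_trans bt.
Qed.

(** What the computations with distribution functions use. It covers both a finite deficient
    topological measure with a continuous f and a finite Borel measure with an f whose superlevel
    sets are merely Borel. *)
Definition superlevel_monotone nu f : Prop :=
  [/\ nu set0 = 0%E, nu setT \is a fin_num, forall t, (0 <= nu (superlevel f t))%E,
      forall t, (nu (superlevel f t) <= nu setT)%E &
      forall s t, s <= t -> (nu (superlevel f t) <= nu (superlevel f s))%E].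

Lemma dtm_superlevel_monotone nu f : DTM R X nu -> continuous f ->
  superlevel_monotone nu f.
Proof.
move=> dnu cf; have oT : open_closed [set: X] by left; exact: openT.
have osl t : open_closed (superlevel f t) by left; exact: open_superlevel.
split.
- exact: (dtm_set0 dnu.1).
- exact: dtm_fin_num.
- by move=> t; exact: (dtm_ge0 dnu.1).
- by move=> t; exact: (dtm_le dnu.1).
- by move=> s t st; apply: (dtm_le dnu.1) => //; exact: superlevel_le.
Qed.

Section Monotone.
Variables (nu : set X -> \bar R) (f : X -> R).
Hypothesis mono : superlevel_monotone nu f.

Lemma superlevel_fin_num t : nu (superlevel f t) \is a fin_num.
Proof.
have [_ nuT nu0 nul _] := mono; rewrite ge0_fin_numE//.
by apply: le_lt_trans (nul t) _; rewrite ltey_eq nuT.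
Qed.

Let G t : R := fine (nu (superlevel f t)).

Let nuG t : nu (superlevel f t) = (G t)%:E.
Proof. by rewrite /G fineK// superlevel_fin_num. Qed.

Let G_ge0 t : 0 <= G t.
Proof. by rewrite fine_ge0//; have [] := mono. Qed.

Let G_ni : nonincreasing_fun G.
Proof.
move=> s t st; rewrite /G fine_le ?superlevel_fin_num//.
by have [_ _ _ _ ->] := mono.
Qed.

Lemma measurable_superlevel (D : set R) : measurable D ->
  measurable_fun D (fun t => nu (superlevel f t)).
Proof.
move=> mD; under eq_fun do rewrite nuG.
by apply/measurable_EFinP; exact: nonincreasing_measurable.
Qed.

Lemma integral_superlevel_ge0 a b :
  (0 <= \int[lebesgue_measure]_(t in `[a, b]) nu (superlevel f t))%E.
Proof. by apply: integral_ge0 => t _; have [] := mono. Qed.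

Lemma integral_superlevel_le a b : a <= b ->
  (\int[lebesgue_measure]_(t in `[a, b]) nu (superlevel f t) <=
   (b - a)%:E * nu setT)%E.
Proof.
move=> ab; have [_ _ nu0 nul _] := mono.
apply: (@le_trans _ _ (\int[lebesgue_measure]_(t in `[a, b]) (cst (nu setT) t))%E).
  by apply: ge0_le_integral => //; exact: measurable_superlevel.
rewrite integral_cst//= lebesgue_measure_itv/= lte_fin muleC.
move: ab; rewrite le_eqVlt => /predU1P[->|-> //].
by rewrite ltxx subrr !mul0e.
Qed.

Lemma integral_superlevel_fin_num a b :
  (\int[lebesgue_measure]_(t in `[a, b]) nu (superlevel f t))%E \is a fin_num.
Proof.
have [ab|ba] := leP a b; last first.
  by rewrite set_itv_ge ?integral_set0// bnd_simp -ltNge.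
rewrite ge0_fin_numE ?integral_superlevel_ge0//.
apply: le_lt_trans (integral_superlevel_le ab) _; have [_ nuT _ _ _] := mono.
by rewrite ltey_eq fin_numM.
Qed.

Lemma qint_bounds a b : (forall x, a <= f x <= b) ->
  qint nu f = fine (\int[lebesgue_measure]_(t in `[a, b]) nu (superlevel f t)) +
              a * fine (nu setT).
Proof.
move=> fab; have [nu0 nuT _ _ _] := mono.
have qE a' b' :
    fine (\int[lebesgue_measure]_(t in `[a', b']) nu (superlevel f t)
          + a'%:E * nu setT)%E =
    fine (\int[lebesgue_measure]_(t in `[a', b']) nu (superlevel f t)) +
    a' * fine (nu setT).
  by rewrite fineD ?fineM ?fin_numM// integral_superlevel_fin_num.
rewrite -qE /qint.
have : forall x, let ab := xget (0, 0) [set ab : R * R |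
    forall x, ab.1 <= f x <= ab.2] in ab.1 <= f x <= ab.2.
  by case: xgetP => [//|/(_ (a, b))].
set ab := xget _ _; case: ab => a' b' /= fab'; congr fine.
have [x0|X0] := pselect (exists x0 : X, True); last first.
  have XT (A : set X) : A = set0.
    by apply/seteqP; split => // x _; apply: X0; exists x.
  rewrite [setT]XT nu0 !mule0; congr (_ + _)%E.
  by rewrite !integral0_eq// => t _; rewrite (XT (superlevel f t)).
have {x0} [x0 _] := x0.
have nuTE : nu setT = (fine (nu setT))%:E by rewrite fineK.
have widen a1 b1 a2 b2 : (forall x, a1 <= f x <= b1) -> a2 <= a1 -> b1 <= b2 ->
    (\int[lebesgue_measure]_(t in `[a2, b2]) nu (superlevel f t) + a2%:E * nu setT =
     \int[lebesgue_measure]_(t in `[a1, b1]) nu (superlevel f t) + a1%:E * nu setT)%E.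
  move=> f1 a21 b12; rewrite nuTE.
  under eq_integral do rewrite nuG; under [in RHS]eq_integral do rewrite nuG.
  apply: integral_itv_widen => //.
  - by have /andP[] := f1 x0; exact: le_trans.
  - move=> t ta; rewrite /G (superlevel_setT _ ta)// => x.
    by have /andP[] := f1 x.
  - move=> t ta; rewrite /G (superlevel_set0 _ ta) ?nu0// => x.
    by have /andP[] := f1 x.
(* Neither interval need contain the other, so both are compared with a common enlargement. *)
rewrite -(widen a b (Num.min a a') (Num.max b b'))//.
- rewrite -(widen a' b' (Num.min a a') (Num.max b b'))//.
  + by rewrite ge_min lexx orbT.
  + by rewrite le_max lexx orbT.
- by rewrite ge_min lexx.
- by rewrite le_max lexx.
Qed.

End Monotone.

Lemma qint_pos nu f c : superlevel_monotone nu f -> (forall x, 0 <= f x <= c) ->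
  qint nu f = fine (\int[lebesgue_measure]_(t in `[0%R, c]) nu (superlevel f t)).
Proof. by move=> mono fc; rewrite (qint_bounds mono fc) mul0r addr0. Qed.

Lemma qint_pos_norm_le nu f c : superlevel_monotone nu f -> 0 <= c ->
  (forall x, 0 <= f x <= c) -> `|qint nu f| <= c * fine (nu setT).
Proof.
move=> mono c0 fc; rewrite (qint_pos mono fc) ger0_norm; last first.
  by rewrite fine_ge0// integral_superlevel_ge0.
have [_ nuT _ _ _] := mono.
have := integral_superlevel_le mono c0; rewrite subr0 => h.
have -> : c * fine (nu setT) = fine (c%:E * nu setT)%E by rewrite fineM.
by rewrite fine_le// ?fin_numM// integral_superlevel_fin_num.
Qed.

Lemma eq_qint nu nu' f : (forall t, nu (superlevel f t) = nu' (superlevel f t)) ->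
  nu setT = nu' setT -> qint nu f = qint nu' f.
Proof.
move=> nn nT; rewrite /qint nT; congr (fine (_ + _)).
by apply: eq_integral => t _.
Qed.

(** Linearity in the set function: the nonnegative distribution functions are integrated term by
    term over [-M, M], and the mass terms form a second convergent series. *)
Lemma qint_series (c : R^nat) (nu : nat -> set X -> \bar R) f (M : R) :
  hausdorff_space X -> (forall i, 0 <= c i) -> (forall i, DTM R X (nu i)) ->
  (\sum_(0 <= i <oo) (c i)%:E * nu i [set: X] < +oo)%E ->
  continuous f -> (forall x, `|f x| <= M) ->
  series (fun i => c i * qint (nu i) f) @ \oo -->
  qint (fun A => \sum_(0 <= i <oo) (c i)%:E * nu i A)%E f.
Proof.
move=> hX c0 dnu cnu cf fM.
have fab x : - M <= f x <= M by rewrite -ler_norml.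
have mono i := dtm_superlevel_monotone (dnu i) cf.
have monoS := dtm_superlevel_monotone (series_dtm hX c0 dnu cnu) cf.
rewrite (qint_bounds monoS fab).
pose I i : R := fine (\int[lebesgue_measure]_(t in `[(- M)%R, M]) nu i (superlevel f t))%E.
pose J i : R := fine (nu i setT).
have JE : (\sum_(0 <= i <oo) (c i)%:E * nu i setT =
           \sum_(0 <= i <oo) (c i * J i)%:E)%E.
  by apply: eq_eseriesr => i _; rewrite EFinM fineK//; have [] := mono i.
have IE : (\int[lebesgue_measure]_(t in `[(- M)%R, M])
    (\sum_(0 <= i <oo) (c i)%:E * nu i (superlevel f t)) =
    \sum_(0 <= i <oo) (c i * I i)%:E)%E.
  rewrite integral_nneseries//.
  - apply: eq_eseriesr => i _; rewrite ge0_integralZl//.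
    + by rewrite EFinM fineK// integral_superlevel_fin_num.
    + exact: measurable_superlevel.
    + by move=> t _; have [] := mono i.
    + by rewrite lee_fin.
  - by move=> i; apply: measurable_funeM; exact: measurable_superlevel.
  - by move=> i t _; rewrite mule_ge0 ?lee_fin//; have [] := mono i.
have Ifin := integral_superlevel_fin_num monoS (- M) M.
rewrite IE JE; rewrite IE in Ifin.
have -> : series (fun i => c i * qint (nu i) f) =
    series (fun i => c i * I i) + (fun n => - M * series (fun i => c i * J i) n).
  apply/funext => n; rewrite /= fctE /= !seriesEnat/= mulr_sumr -big_split/=.
  by apply: eq_bigr => i _; rewrite (qint_bounds (mono i) fab) -/(I i) -/(J i); ring.
apply: cvgD.
  apply: cvg_series_fine.
    by move=> i; rewrite mulr_ge0// fine_ge0// integral_superlevel_ge0.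
  by rewrite ltey_eq Ifin.
apply: cvgMl_tmp; apply: cvg_series_fine.
  by move=> i; rewrite mulr_ge0// fine_ge0//; have [_ _ _ _ _] := mono i;
     exact: (dtm_ge0 (dnu i).1 (or_introl openT)).
by rewrite -JE.
Qed.

End QuasiIntegral.

(** * Layer cake formula and integration against Borel measures *)

Section LayerCake.
Context {d : measure_display} {T : measurableType d} {R : realType}.
Variable P : {finite_measure set T -> \bar R}.
Local Open Scope ereal_scope.

Let leb : {measure set _ -> \bar R} := @lebesgue_measure R.

(** Tonelli on the region a <= t < g y: its section at t in [a, b] is {g > t}, and its section at y
    is an interval of length g y - a. *)
Lemma layer_cake (g : T -> R) (a b : R) : measurable_fun setT g ->
  (forall y, (a <= g y <= b)%R) ->
  \int[lebesgue_measure]_(t in `[a, b]) P (superlevel g t) =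
  \int[P]_y (g y - a)%:E.
Proof.
move=> mg gab; pose GR := measurableTypeR R.
transitivity (\int[leb]_t \int[P]_y (\1_(`[a, g y[%classic) t)%:E).
  rewrite integral_mkcond; apply: eq_integral => t _; rewrite patchE.
  case: ifPn => [|nt].
    rewrite inE/= in_itv/= => /andP[at_ tb].
    rewrite -[superlevel g t]setIT -integral_indic//=; last first.
      rewrite -[X in measurable X]setTI; apply: mg => //.
      by rewrite -set_itvoy; exact: measurable_itv.
    by apply: eq_integral => y _; rewrite !indicE; congr ((_ _)%:R%:E);
       apply/idP/idP; rewrite !inE/= in_itv/= at_.
  rewrite integral0_eq// => y _; rewrite indicE memNset//= in_itv/=.
  move=> /andP[at_ tg]; move: nt; rewrite notin_setE/= in_itv/= at_/=; apply.
  by have /andP[_] := gab y; apply: le_trans; exact: ltW.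
rewrite -(@fubini_tonelli _ _ T GR R P leb
  (fun p : T * GR => (\1_(`[a, g p.1[%classic) p.2)%:E))//=.
- apply: eq_integral => y _; rewrite integral_indic// setIT.
  rewrite [LHS](lebesgue_measure_itv `[a, g y[)/= lte_fin; have /andP[+ _] := gab y.
  by rewrite le_eqVlt => /predU1P[->|->//]; rewrite ltxx subrr.
- apply/measurable_EFinP/measurable_indic => /=.
  pose fsnd (p : T * GR) := (a <= p.2)%R.
  pose f21 (p : T * GR) := (p.2 < g p.1)%R.
  rewrite [X in measurable X](_ : _ =
      fsnd @^-1` [set true] `&` f21 @^-1` [set true]); last first.
    by apply/seteqP; split => p; rewrite /= in_itv/= => /andP.
  apply: measurableI.
  - have : measurable_fun setT fsnd by exact: measurable_fun_ler.
    by move=> /(_ measurableT [set true]); rewrite setTI; exact.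
  - have : measurable_fun setT f21.
      by apply: measurable_fun_ltr => //; exact: measurableT_comp.
    by move=> /(_ measurableT [set true]); rewrite setTI; exact.
Qed.

Section Series.
Variables (alpha : R^nat) (g : nat -> T -> R) (C A : R).
Hypotheses (alpha0 : (forall i, 0 <= alpha i)%R) (cA : series alpha @ \oo --> A).
Hypotheses (mg : forall i, measurable_fun setT (g i))
  (gC : (forall i y, `|g i y| <= C)%R).

Let G y := limn (series (fun i => alpha i * g i y))%R.

Let cAC : series (fun i => alpha i * C)%R @ \oo --> (A * C)%R.
Proof. exact: cvg_seriesMr. Qed.

Let gle i y : (`|alpha i * g i y| <= alpha i * C)%R.
Proof. by rewrite normrM ger0_norm// ler_wpM2l. Qed.

Let cG y : series (fun i => alpha i * g i y)%R @ \oo --> G y.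
Proof.
apply: (series_abs_cvg (v := fun i => alpha i * C)%R) => //.
by apply/cvg_ex; exists (A * C)%R.
Qed.

Lemma measurable_fun_series_lim : measurable_fun setT G.
Proof.
apply: (@measurable_fun_cvg _ _ _ _
  (fun n y => series (fun i => alpha i * g i y)%R n)) => [n|y _]; last exact: cG.
rewrite /series/=; apply: measurable_sum => i.
by apply: measurable_funM.
Qed.

(* By the layer cake formula both sides integrate [sum_i alpha_i (g_i + C)],
   a series of nonnegative functions. *)
Lemma integral_superlevel_series :
  \sum_(0 <= i <oo) (alpha i)%:E *
    \int[lebesgue_measure]_(t in `[(- C)%R, C]) P (superlevel (g i) t) =
  \int[lebesgue_measure]_(t in `[(- (A * C))%R, (A * C)%R]) P (superlevel G t).
Proof.
have mG := measurable_fun_series_lim.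
have GC y : (`|G y| <= A * C)%R.
  by have := series_tail_le 0 (gle^~ y) (@cG y) cAC; rewrite !seriesEnat/= !big_geq// !subr0.
rewrite (layer_cake mG); last by move=> y; rewrite -ler_norml.
under eq_eseriesr => i _.
  rewrite (layer_cake (mg i)); last by move=> y; rewrite -ler_norml.
  over.
have gC0 i y : (0 <= g i y - - C)%R.
  by rewrite opprK -lerBlDr sub0r; have := gC i y; rewrite ler_norml => /andP[].
have mgC i : measurable_fun setT (fun y => (g i y - - C)%R%:E).
  by apply/measurable_EFinP; apply: measurable_funB.
transitivity (\int[P]_y \sum_(0 <= i <oo) (alpha i)%:E * (g i y - - C)%:E).
  rewrite integral_nneseries//.
  - apply: eq_eseriesr => i _; rewrite ge0_integralZl// ?lee_fin//.
    by move=> y _; rewrite lee_fin.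
  - by move=> i; apply: measurable_funeM.
  - by move=> i y _; rewrite mule_ge0 ?lee_fin.
apply: eq_integral => y _.
under eq_eseriesr do rewrite -EFinM.
have cs : series (fun i => alpha i * (g i y - - C))%R @ \oo --> (G y - - (A * C))%R.
  rewrite (_ : series _ = (fun n => series (fun i => alpha i * g i y)%R n
      + series (fun i => alpha i * C)%R n)%R).
    by rewrite opprK; apply: cvgD.
  apply/funext => n; rewrite !seriesEnat/= -big_split/=.
  by apply: eq_bigr => i _; rewrite opprK mulrDr.
by rewrite nneseries_cvg ?(cvg_lim _ cs)// => i; rewrite mulr_ge0.
Qed.

End Series.

End LayerCake.

(* Library measures are nonnegative on all sets whereas [m] is unconstrained off
   the sigma-algebra, hence the absolute value. *)
Lemma exists_finite_measure (R : realType) (T : pointedType) (G : set (set T))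
    (m : set T -> \bar R) :
  m set0 = 0%E -> (forall A, <<s G >> A -> 0 <= m A)%E ->
  (forall F : (set T)^nat, (forall i, <<s G >> (F i)) -> trivIset setT F ->
    m (\bigcup_i F i) = \sum_(0 <= i <oo) m (F i))%E ->
  (m [set: T] < +oo)%E ->
  exists P : {finite_measure set (g_sigma_algebraType G) -> \bar R},
    forall A, <<s G >> A -> P A = m A.
Proof.
move=> m0 mge0 msigma mT; pose p (A : set (g_sigma_algebraType G)) := `|m A|%E.
have pE A : <<s G >> A -> p A = m A by move=> GA; rewrite /p gee0_abs// mge0.
have p0 : p set0 = 0%E by rewrite /p m0 abse0.
have pge0 A : (0 <= p A)%E by exact: abse_ge0.
have psigma : semi_sigma_additive p.
  move=> F mF tF mUF; rewrite pE// msigma//.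
  rewrite (_ : (fun n => _) = (fun n => \sum_(0 <= i < n) m (F i))%E).
    by apply: is_cvg_nneseries => i _ _; exact: mge0 (mF i).
  by apply/funext => n; apply: eq_bigr => i _; rewrite pE//; exact: mF.
pose p1 := isMeasure.Build _ (g_sigma_algebraType G) R p p0 pge0 psigma.
pose P1 : {measure set _ -> \bar R} := HB.pack p p1.
have fin : fin_num_fun P1.
  move=> A mA; have mAT : (P1 A <= P1 setT)%E by apply: le_measure; rewrite ?inE.
  rewrite ge0_fin_numE ?measure_ge0//; apply: le_lt_trans mAT _.
  by rewrite /P1/= pE//; exact: (@measurableT _ (g_sigma_algebraType G)).
pose p2 := Measure_isFinite.Build _ (g_sigma_algebraType G) R P1 fin.
pose P2 : {finite_measure set _ -> \bar R} := HB.pack p p1 p2.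
by exists P2 => A; exact: pE.
Qed.

Section GeneratedMeasure.
Context {R : realType} {T : pointedType} {G : set (set T)} {m : set T -> \bar R}.
Hypotheses (m0 : m set0 = 0%E) (m_ge0 : forall A, <<s G >> A -> (0 <= m A)%E).
Hypothesis m_sigma : forall F : (set T)^nat, (forall i, <<s G >> (F i)) ->
  trivIset setT F -> (m (\bigcup_i F i) = \sum_(0 <= i <oo) m (F i))%E.
Hypothesis mT : (m [set: T] < +oo)%E.

Lemma generated_measure_le A B : <<s G >> A -> <<s G >> B -> A `<=` B ->
  (m A <= m B)%E.
Proof.
have [P Pm] := exists_finite_measure m0 m_ge0 m_sigma mT.
by move=> GA GB AB; rewrite -!Pm//; apply: le_measure; rewrite ?inE.
Qed.

Lemma generated_measure_add A B : <<s G >> A -> <<s G >> B -> A `&` B = set0 ->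
  (m (A `|` B) = m A + m B)%E.
Proof.
have [P Pm] := exists_finite_measure m0 m_ge0 m_sigma mT.
move=> GA GB AB; rewrite -!Pm//; first exact: measureU.
exact: (@measurableU _ (g_sigma_algebraType G)).
Qed.

Lemma generated_measurable_fun (g : T -> R) : (forall t, <<s G >> (superlevel g t)) ->
  measurable_fun setT (g : g_sigma_algebraType G -> R).
Proof.
move=> gG; apply: (measurability _ (RGenOInfty.measurableE R)).
move=> _ [_ [t ->] <-]; rewrite setTI; have := gG t; rewrite -/(measurable _).
by congr (<<s G >> _); apply/seteqP; split => y /=; rewrite in_itv/= andbT.
Qed.

(** [m] and the measure [P] are known to agree only on the generated sigma-algebra; this is why the
    superlevel sets of the sum are shown to belong to it along with the identity. *)
Lemma generated_superlevel_series (alpha : R^nat) (g : nat -> T -> R) (C A : R) :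
  (forall i, 0 <= alpha i)%R -> series alpha @ \oo --> A ->
  (forall i t, <<s G >> (superlevel (g i) t)) -> (forall i y, `|g i y| <= C)%R ->
  let S y := limn (series (fun i => alpha i * g i y))%R in
  (forall t, <<s G >> (superlevel S t)) /\
  (\sum_(0 <= i <oo) (alpha i)%:E *
    \int[lebesgue_measure]_(t in `[(- C)%R, C]) m (superlevel (g i) t) =
  \int[lebesgue_measure]_(t in `[(- (A * C))%R, (A * C)%R]) m (superlevel S t))%E.
Proof.
have [P Pm] := exists_finite_measure m0 m_ge0 m_sigma mT.
move=> alpha0 cA gG gC S.
have mg i := generated_measurable_fun (gG i).
have mS : measurable_fun setT (S : g_sigma_algebraType G -> R).
  exact: measurable_fun_series_lim cA mg gC.
have SG t : <<s G >> (superlevel S t).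
  have := mS measurableT `]t, +oo[%classic (measurable_itv _).
  by rewrite setTI set_itvoy.
split=> //; have := integral_superlevel_series P alpha0 cA mg gC.
move=> PS; transitivity (\sum_(0 <= i <oo) (alpha i)%:E *
    \int[lebesgue_measure]_(t in `[(- C)%R, C]) P (superlevel (g i) t))%E.
  apply: eq_eseriesr => i _; congr (_ * _)%E.
  by apply: eq_integral => t _; rewrite Pm.
by rewrite PS; apply: eq_integral => t _; rewrite Pm.
Qed.

End GeneratedMeasure.

Section BorelMeasures.
Context {R : realType} {Y : topologicalType}.
Variable m : set Y -> \bar R.
Hypotheses (m_rbm : regular_borel_measure m) (mY : (m [set: Y] < +oo)%E).

Let borelT : <<s open >> [set: Y].
Proof. by apply: sub_sigma_algebra; exact: openT. Qed.

Let fin_mY : m [set: Y] \is a fin_num.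
Proof. by rewrite ge0_fin_numE// (rbm_ge0 m_rbm). Qed.

(** A base point turns [Y] into a pointed type with the same open sets. On the empty space all sets
    coincide, and the lemmas below treat it separately. *)
Let pointed_at (y0 : Y) : pointedType :=
  HB.pack (Topological.sort Y) (isPointed.Build (Topological.sort Y) y0).

Lemma borel_measure_le A B : <<s open >> A -> <<s open >> B -> A `<=` B ->
  (m A <= m B)%E.
Proof.
have [[y0 _]|Y0] := pselect (exists y0 : Y, True).
  exact: (generated_measure_le (T := pointed_at y0) (rbm0 m_rbm) (rbm_ge0 m_rbm)
    (rbm_sigma_additive m_rbm) mY).
have YT (A' : set Y) : A' = set0.
  by apply/seteqP; split => // y _; apply: Y0; exists y.
by rewrite (YT A) (YT B).
Qed.

Lemma borel_measure_add A B : <<s open >> A -> <<s open >> B -> A `&` B = set0 ->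
  (m (A `|` B) = m A + m B)%E.
Proof.
have [[y0 _]|Y0] := pselect (exists y0 : Y, True).
  exact: (generated_measure_add (T := pointed_at y0) (rbm0 m_rbm) (rbm_ge0 m_rbm)
    (rbm_sigma_additive m_rbm) mY).
have YT (A' : set Y) : A' = set0.
  by apply/seteqP; split => // y _; apply: Y0; exists y.
by move=> _ _ _; rewrite (YT A) (YT B) setU0 (rbm0 m_rbm) adde0.
Qed.

Lemma borel_superlevel_monotone (g : Y -> R) :
  (forall t, <<s open >> (superlevel g t)) -> superlevel_monotone m g.
Proof.
move=> gB; split => //.
- exact: (rbm0 m_rbm).
- by move=> t; exact: (rbm_ge0 m_rbm).
- by move=> t; exact: borel_measure_le.
- by move=> s t st; apply: borel_measure_le => //; exact: superlevel_le.
Qed.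

(** Countable additivity in the function, the place where a genuine measure is used. The lower ends
    -C, weighted by [alpha i], add up to the lower end for the sum, so the mass terms match as
    well. *)
Lemma qint_borel_series (alpha : R^nat) (g : nat -> Y -> R) (C : R) :
  (forall i, 0 <= alpha i) -> cvgn (series alpha) ->
  (forall i t, <<s open >> (superlevel (g i) t)) -> (forall i y, `|g i y| <= C) ->
  series (fun i => alpha i * qint m (g i)) @ \oo -->
  qint m (fun y => limn (series (fun i => alpha i * g i y))).
Proof.
move=> alpha0 calpha gB gC; set S := fun y : Y => limn _.
have mono i := borel_superlevel_monotone (gB i).
have [[y0 _]|Y0] := pselect (exists y0 : Y, True); last first.
  have YT (A : set Y) : A = set0.
    by apply/seteqP; split => // y _; apply: Y0; exists y.
  have q0 (h : Y -> R) : qint m h = 0.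
    rewrite /qint [setT]YT (rbm0 m_rbm) mule0 adde0 integral0_eq// => t _.
    by rewrite [X in m X]YT (rbm0 m_rbm).
  rewrite q0 (_ : series _ = cst 0); first exact: cvg_cst.
  apply/funext => n; rewrite seriesEnat/= big1// => i _.
  by rewrite q0 mulr0.
pose A := limn (series alpha).
have [SB Sint] := generated_superlevel_series (T := pointed_at y0) (rbm0 m_rbm)
  (rbm_ge0 m_rbm) (rbm_sigma_additive m_rbm) mY alpha0 calpha gB gC.
rewrite -/S -/A in SB Sint.
have monoS := borel_superlevel_monotone SB.
have SC y : `|S y| <= A * C.
  have cAC : series (fun i => alpha i * C) @ \oo --> A * C by exact: cvg_seriesMr.
  have gle i : `|alpha i * g i y| <= alpha i * C.
    by rewrite normrM ger0_norm// ler_wpM2l.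
  have cS : cvgn (series (fun i => alpha i * g i y)).
    by apply: (series_abs_cvg gle); apply/cvg_ex; exists (A * C).
  by have := series_tail_le 0 gle cS cAC; rewrite !seriesEnat/= !big_geq// !subr0.
have Sb y : - (A * C) <= S y <= A * C by rewrite -ler_norml.
have gb i y : - C <= g i y <= C by rewrite -ler_norml.
rewrite (qint_bounds monoS Sb) -Sint.
have Ifin := integral_superlevel_fin_num monoS (- (A * C)) (A * C).
rewrite -Sint in Ifin.
pose I i := fine (\int[lebesgue_measure]_(t in `[(- C)%R, C]) m (superlevel (g i) t))%E.
have IE : (\sum_(0 <= i <oo) (alpha i)%:E *
      \int[lebesgue_measure]_(t in `[(- C)%R, C]) m (superlevel (g i) t) =
    \sum_(0 <= i <oo) (alpha i * I i)%:E)%E.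
  apply: eq_eseriesr => i _; rewrite EFinM fineK//.
  exact: integral_superlevel_fin_num.
rewrite IE in Ifin; rewrite IE.
rewrite (_ : series _ = (fun n => series (fun i => alpha i * I i) n
    + series alpha n * (- C * fine (m setT)))); last first.
  apply/funext => n; rewrite !seriesEnat/= mulr_suml -big_split/=.
  by apply: eq_bigr => i _; rewrite (qint_bounds (mono i) (gb i)) mulrDr.
rewrite (_ : - (A * C) * _ = A * (- C * fine (m setT))); last by ring.
apply: cvgD; last by apply: cvgMr_tmp.
apply: cvg_series_fine => [i|]; last by rewrite ltey_eq Ifin.
by rewrite mulr_ge0// fine_ge0// integral_superlevel_ge0.
Qed.

End BorelMeasures.

(** * Signed functions against a Borel measure *)

Section QuasiHomBorel.
Context {R : realType} {X Y : topologicalType}.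
Hypotheses (hX : hausdorff_space X) (hY : hausdorff_space Y).
Hypotheses (lX : locally_compact [set: X]) (rX : regular_space X).
Variables (q : set X -> set Y) (f : X -> R).
Hypotheses (dq : d_image_transformation q) (f0 : C0 R X f).

Let oT : open_compact [set: X]. Proof. by left; exact: openT. Qed.

Let osl t : open (superlevel f t).
Proof. by apply: open_superlevel; exact: f0.1. Qed.

Lemma borel_quasi_hom_superlevel t : <<s open >> (superlevel (quasi_hom q f) t).
Proof.
have qB U : open U -> <<s open >> (q U).
  by move=> oU; apply: sub_sigma_algebra; exact: (dit_open dq).
have [t0|t0] := leP 0 t; first by rewrite quasi_hom_superlevel//; exact: qB.
rewrite quasi_hom_superlevel_neg// -bigcup2E.
apply: (@sigma_algebra_bigcup _ setT) => -[|[|n]] /=.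
- exact: qB.
- by rewrite -setTD; apply: sigma_algebraCD; apply: qB; exact: openT.
- exact: sigma_algebra0.
Qed.

(** Let k be the measure of the complement of q(X). Every level t < 0 carries an extra k, hence the
    integral an extra c k over [-c, 0); the mass term -c m(Y) differs from -c m(q(X)) by -c k, and
    the two contributions cancel. *)
Lemma qint_borel_quasi_hom (mu m : set Y -> \bar R) : DTM R Y mu ->
  restricts_to m mu -> qint m (quasi_hom q f) = qint (adjoint q mu) f.
Proof.
move=> dmu [rm mmu]; have [c c0 fc] := C0_bounded f0.
have oYT : open_closed [set: Y] by left; exact: openT.
have mY : (m [set: Y] < +oo)%E by rewrite mmu//; exact: dmu.2.
have mono1 := borel_superlevel_monotone rm mY borel_quasi_hom_superlevel.
have mono2 := dtm_superlevel_monotone (adjoint_dtm hX hY lX rX dq dmu) f0.1.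
have fb x : - c <= f x <= c by rewrite -ler_norml.
have qfb y : - c <= quasi_hom q f y <= c.
  by rewrite -ler_norml; exact: quasi_hom_norm_le.
rewrite (qint_bounds mono1 qfb) (qint_bounds mono2 fb).
have qBT : <<s open >> (q setT).
  by apply: sub_sigma_algebra; apply: (dit_open dq); exact: openT.
have qBC : <<s open >> (~` q setT).
  by rewrite -setTD; exact: sigma_algebraCD.
have qfin : m (q setT) \is a fin_num.
  rewrite mmu; last by left; apply: (dit_open dq); exact: openT.
  by apply: dtm_fin_num => //; left; apply: (dit_open dq); exact: openT.
have mYT : (m [set: Y] = m (q setT) + m (~` q setT))%E.
  by rewrite -(borel_measure_add rm mY)// ?setICr// setUv.
have Cfin : m (~` q setT) \is a fin_num.
  rewrite ge0_fin_numE ?(rbm_ge0 rm)//; apply: le_lt_trans mY.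
  by rewrite mYT leeDr// (rbm_ge0 rm).
pose k := fine (m (~` q setT)).
have kE : m (~` q setT) = k%:E by rewrite /k fineK.
have k0 : 0 <= k by rewrite fine_ge0// (rbm_ge0 rm).
have lev t : m (superlevel (quasi_hom q f) t) =
    (adjoint q mu (superlevel f t) + (\1_(`]-oo, 0[%classic) t * k)%:E)%E.
  have oqs : open (q (superlevel f t)) by exact: (dit_open dq).
  rewrite adjointE; last by left.
  rewrite -mmu; last by left.
  have [t0|t0] := leP 0 t.
    rewrite quasi_hom_superlevel// indicE memNset ?mul0r ?adde0//.
    by rewrite /= in_itv/= ltNge t0.
  rewrite quasi_hom_superlevel_neg// indicE mem_set ?mul1r/=; last by rewrite in_itv.
  rewrite borel_measure_add ?kE//; first exact: sub_sigma_algebra.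
  apply/seteqP; split => // y [qy]; apply; move: qy.
  by apply: dit_sub_setT => //; left.
have -> : (\int[lebesgue_measure]_(t in `[(- c)%R, c])
      m (superlevel (quasi_hom q f) t) =
    \int[lebesgue_measure]_(t in `[(- c)%R, c]) adjoint q mu (superlevel f t)
    + (c * k)%:E)%E.
  under eq_integral do rewrite lev.
  rewrite ge0_integralD//=.
  - congr (_ + _)%E; under eq_integral do rewrite EFinM muleC.
    rewrite ge0_integralZl//=; last first.
      by apply/measurable_EFinP; exact: measurable_indic.
    rewrite integral_indic//= (_ : _ `&` _ = `[(- c)%R, 0%R[%classic); last first.
      apply/seteqP; split => t /=; rewrite !in_itv/=.
        by move=> [-> /andP[->]].
      by move=> /andP[ct t0]; rewrite t0 ct (le_trans (ltW t0)).
    rewrite lebesgue_measure_itv/= lte_fin oppr_lt0 opprK add0r muleC EFinM.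
    by move: c0; rewrite le_eqVlt => /predU1P[<-|->//]; rewrite ltxx mul0e.
  - by move=> t _; have [] := mono2.
  - exact: measurable_superlevel.
  - by move=> t _; rewrite lee_fin mulr_ge0.
  - by apply/measurable_EFinP; apply: measurable_funM => //; exact: measurable_indic.
have Ifin := integral_superlevel_fin_num mono2 (- c) c.
set I := integral _ _ _ in Ifin *.
rewrite (fineD Ifin)// mYT (fineD qfin Cfin) -/k adjointE// -mmu; last first.
  by left; apply: (dit_open dq); exact: openT.
rewrite [fine (c * k)%:E]/=; ring.
Qed.

End QuasiHomBorel.

(** * Uniformly convergent series of functions *)

Section UniformSeries.
Context {R : realType}.

(** The domination is required only eventually along F, so that F may be a neighbourhood filter
    restricted to a subset. *)
Lemma cvg_limn_series (Z : Type) (F : set_system Z) (FF : Filter F)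
    (h : nat -> Z -> R) (v : R^nat) (z0 : Z) :
  cvgn (series v) -> (forall i, h i z @[z --> F] --> h i z0) ->
  (forall i, `|h i z0| <= v i) -> (\forall z \near F, forall i, `|h i z| <= v i) ->
  limn (series (h^~ z)) @[z --> F] --> limn (series (h^~ z0)).
Proof.
move=> cv hF h0 hv; have cs z : (forall i, `|h i z| <= v i) ->
    series (h^~ z) @ \oo --> limn (series (h^~ z)).
  by move=> hz; exact: series_abs_cvg hz cv.
have partial n : series (h^~ z) n @[z --> F] --> series (h^~ z0) n.
  rewrite /series/=; elim: n => [|n ih].
    by rewrite big_geq//; under eq_fun do rewrite big_geq//; exact: cvg_cst.
  rewrite big_nat_recr//=; under eq_fun do rewrite big_nat_recr//=.
  exact: cvgD.
(* Two tails and one difference of partial sums, each below e / 4. *)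
apply/cvgrPdist_lt => e e0; have e40 : 0 < e / 4 by rewrite divr_gt0.
have /cvgrPdist_lt/(_ _ e40)[n _ /(_ n (leqnn n))/= vn] := cv.
have hp := cvgr_dist_lt _ _ (partial n) _ e40.
refine (filterS2 FF _ hv (hp FF)) => z hz pz.
have t0 := series_tail_le n h0 (cs _ h0) cv.
have t1 := series_tail_le n hz (cs _ hz) cv.
have := le_lt_trans (ler_norm _) vn; move: t0 t1 pz.
set a := limn (series (h^~ z0)); set b := limn (series (h^~ z)).
set a' := series (h^~ z0) n; set b' := series (h^~ z) n.
rewrite !ler_norml !ltr_norml => /andP[? ?] /andP[? ?] /andP[? ?] ?.
by apply/andP; split; lra.
Qed.

End UniformSeries.

Section C0Series.
Context {R : realType} {Y : topologicalType}.
Implicit Types (f g : Y -> R).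

Lemma C0_cst0 : C0 R Y (fun=> 0).
Proof.
split; first by move=> y; exact: cvg_cst.
move=> e e0; rewrite (_ : [set _ | _] = set0); first exact: compact0.
by apply/seteqP; split => // y /=; rewrite normr0 leNgt e0.
Qed.

Lemma closed_norm_ge f (e : R) : continuous f -> closed [set y | e <= `|f y|].
Proof.
move=> cf; apply: (@preimage_closed _ _ (fun y => `|f y|) [set s | e <= s]).
  by move=> y _; apply: cvg_norm; exact: cf.
exact: closed_ge.
Qed.

Lemma C0D f g : C0 R Y f -> C0 R Y g -> C0 R Y (fun y => f y + g y).
Proof.
move=> [cf fc] [cg gc].
have cfg : continuous (fun y => f y + g y).
  by move=> y; apply: cvgD; [exact: cf|exact: cg].
split=> // e e0; have e20 : 0 < e / 2 by rewrite divr_gt0.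
apply: subclosed_compact (compactU (fc _ e20) (gc _ e20)) _.
  exact: closed_norm_ge.
move=> y /= h; have [fy|fy] := leP (e / 2) `|f y|; first by left.
by right; have := ler_normD (f y) (g y); lra.
Qed.

Lemma C0Z (k : R) f : C0 R Y f -> C0 R Y (fun y => k * f y).
Proof.
move=> [cf fc]; have ckf : continuous (fun y => k * f y).
  by move=> y; apply: cvgMl_tmp; exact: cf.
split=> // e e0; have [->|k0] := eqVneq k 0.
  have [_ /(_ e e0)] := C0_cst0; congr compact; apply/seteqP.
  by split => y /=; rewrite mul0r.
have ek : 0 < e / `|k| by rewrite divr_gt0// normr_gt0.
have := fc _ ek; congr compact; apply/seteqP; split => y /=;
  by rewrite normrM ler_pdivrMr ?normr_gt0// mulrC.
Qed.

(** Continuity is the uniform limit argument. Some partial sum stays within e / 2 of the limit, so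
    where the limit has absolute value at least e, that partial sum has absolute value at least e /
    2, which confines the set to a compact one. *)
Lemma C0_limn_series (alpha : R^nat) (g : nat -> Y -> R) (C : R) :
  (forall i, 0 <= alpha i) -> cvgn (series alpha) ->
  (forall i, C0 R Y (g i)) -> (forall i y, `|g i y| <= C) ->
  C0 R Y (fun y => limn (series (fun i => alpha i * g i y))).
Proof.
move=> alpha0 calpha g0 gC; pose v i := alpha i * C.
have cv : cvgn (series v) by exact: is_cvg_seriesMr.
have gv i y : `|alpha i * g i y| <= v i by rewrite normrM ger0_norm// ler_wpM2l.
have gs y : series (fun i => alpha i * g i y) @ \oo -->
    limn (series (fun i => alpha i * g i y)) by exact: series_abs_cvg (gv^~ y) cv.
have cS : continuous (fun y => limn (series (fun i => alpha i * g i y))).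
  move=> y; apply: (@cvg_limn_series _ _ (nbhs y) _ (fun i y => alpha i * g i y) v) => //.
    by move=> i; apply: cvgMl_tmp; exact: (g0 i).1.
  by apply: nearW => z i; exact: gv.
split=> // e e0; have e20 : 0 < e / 2 by rewrite divr_gt0.
have /cvgrPdist_lt/(_ _ e20)[n _ /(_ n (leqnn n))/= vn] := cv.
have p0 : C0 R Y (fun y => series (fun i => alpha i * g i y) n).
  rewrite /series/=; elim: (n) => [|k ih].
    by under eq_fun do rewrite big_geq//; exact: C0_cst0.
  by under eq_fun do rewrite big_nat_recr//=; apply: C0D => //; exact: C0Z.
apply: subclosed_compact (p0.2 _ e20) _; first exact: closed_norm_ge.
move=> y /=; have := series_tail_le n (gv^~ y) (gs y) cv.
have := le_lt_trans (ler_norm _) vn.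
move=> h1 h2 h3.
have := lerB_dist (limn (series (fun i => alpha i * g i y)))
  (series (fun i => alpha i * g i y) n).
lra.
Qed.

End C0Series.

Lemma nneseries_first2 (R : realType) (x : nat -> \bar R) :
  (forall j, (2 <= j)%N -> x j = 0%E) ->
  (\sum_(0 <= j <oo) x j = x 0%N + x 1%N)%E.
Proof.
move=> x0; apply/cvg_lim => //; apply: cvg_near_cst; exists 2%N => // n /= n2.
rewrite big_ltn ?(ltn_trans _ n2)// big_ltn// big1_seq ?adde0//.
by move=> j /andP[_]; rewrite mem_index_iota => /andP[/x0].
Qed.

(** * The operator S and its dual T *)

Section SeriesAdjoint.
Context {R : realType} {X Y : topologicalType}.
Hypotheses (hX : hausdorff_space X) (hY : hausdorff_space Y).
Hypotheses (lX : locally_compact [set: X]) (rX : regular_space X).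
Variables (alpha : R^nat) (q : nat -> set X -> set Y).
Hypotheses (alpha0 : forall i, 0 <= alpha i) (calpha : cvgn (series alpha)).
Hypothesis dq : forall i, d_image_transformation (q i).

Let S : wk R Y -> wk R X := series_adjoint alpha q.
Let T : (X -> R) -> Y -> R := series_quasi_hom alpha q.
Let A : R := limn (series alpha).

Lemma limn_series_ge0 : 0 <= A.
Proof. by apply: limr_ge => //; apply: nearW => n; exact: sumr_ge0. Qed.

Lemma series_adjoint_setT_le (mu : set Y -> \bar R) : DTM R Y mu ->
  (S mu [set: X] <= A%:E * mu [set: Y])%E.
Proof.
move=> [dmu muY]; have mu0 : (0 <= mu [set: Y])%E.
  by apply: (dtm_ge0 dmu); left; exact: openT.
have -> : (A%:E = \sum_(0 <= i <oo) (alpha i)%:E)%E by rewrite nneseries_cvg.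
rewrite -(fineK (x := mu [set: Y])) ?ge0_fin_numE// muleC -nneseriesZl; last first.
  by move=> i _; rewrite lee_fin.
apply: lee_nneseries => [i _ _|i _].
  by rewrite mule_ge0 ?lee_fin//; exact: (adjoint_ge0 hY _ (dq i)).
rewrite fineK ?ge0_fin_numE// [leRHS]muleC lee_wpmul2l ?lee_fin//.
exact: (adjoint_setT_le (dq i) dmu).
Qed.

Lemma series_adjoint_setT_lty (mu : set Y -> \bar R) : DTM R Y mu ->
  (S mu [set: X] < +oo)%E.
Proof.
move=> dmu; apply: le_lt_trans (series_adjoint_setT_le dmu) _.
by rewrite ltey_eq fin_numM// dtm_fin_num//; left; exact: openT.
Qed.

Lemma series_adjoint_dtm (mu : set Y -> \bar R) : DTM R Y mu -> DTM R X (S mu).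
Proof.
move=> dmu; apply: (series_dtm hX alpha0) => [i|].
  exact: (adjoint_dtm hX hY lX rX (dq i) dmu).
exact: series_adjoint_setT_lty.
Qed.

Lemma series_adjoint_tm (mu : set Y -> \bar R) :
  (forall i, image_transformation (q i)) -> TM R Y mu -> TM R X (S mu).
Proof.
move=> iq tmu; have dmu := TM_DTM tmu; apply: (series_tm hX alpha0).
- by move=> i; exact: (adjoint_dtm hX hY lX rX (dq i) dmu).
- exact: series_adjoint_setT_lty.
- by move=> i; have [] := adjoint_tm hX hY lX rX (iq i) tmu.
Qed.

(** Two exchanges: each adjoint with the series in j, then the order of a nonnegative double series.
    Finiteness of the combined mass serves the first one. *)
Lemma series_adjoint_linear (c : R^nat) (mu : nat -> wk R Y) (B : set X) :
  (forall j, 0 <= c j) -> (forall j, DTM R Y (mu j)) ->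
  (\sum_(0 <= j <oo) (c j)%:E * mu j [set: Y] < +oo)%E ->
  S (fun C => \sum_(0 <= j <oo) (c j)%:E * mu j C)%E B =
  (\sum_(0 <= j <oo) (c j)%:E * S (mu j) B)%E.
Proof.
move=> c0 dmu cmu.
have ad0 i j : (0 <= adjoint (q i) (mu j) B)%E.
  exact: (adjoint_ge0 hY _ (dq i) (dmu j).1).
transitivity (\sum_(0 <= i <oo) \sum_(0 <= j <oo)
    (alpha i)%:E * ((c j)%:E * adjoint (q i) (mu j) B))%E.
  apply: eq_eseriesr => i _.
  rewrite (adjoint_series hX hY lX rX B (dq i) c0 dmu cmu) nneseriesZl// => j _.
  by rewrite mule_ge0 ?lee_fin.
rewrite nneseries_interchange; last by move=> i j; rewrite !mule_ge0 ?lee_fin.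
apply: eq_eseriesr => j _; rewrite -nneseriesZl; last first.
  by move=> i _; rewrite mule_ge0 ?lee_fin.
by apply: eq_eseriesr => i _; rewrite muleCA.
Qed.

Lemma series_adjoint_markov (M : set (wk R Y)) : M `<=` DTM R Y ->
  markov_operator M S.
Proof.
move=> MD a b mu nu a0 b0 /MD dmu /MD dnu B _.
(* The pair is padded to a sequence with zero coefficients; the entries of [m] from index 2 on only
   have to be deficient topological measures. *)
pose c j : R := if j is 0%N then a else if j is 1%N then b else 0.
pose m j : wk R Y := if j is 0%N then mu else nu.
have two (n : nat -> \bar R) :
    (\sum_(0 <= j <oo) (c j)%:E * n j = a%:E * n 0%N + b%:E * n 1%N)%E.
  by rewrite nneseries_first2// => -[|[|j]]// _; rewrite mul0e.
have oT : open_closed [set: Y] by left; exact: openT.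
rewrite (_ : (fun C => _) = (fun C => \sum_(0 <= j <oo) (c j)%:E * m j C)%E); last first.
  by apply/funext => C; rewrite two.
rewrite series_adjoint_linear ?two//.
- by case=> [|[|j]].
- by case=> [|j].
- by rewrite ltey_eq fin_numD !fin_numM// dtm_fin_num.
Qed.

Lemma series_adjoint_convex (M : set (wk R Y)) : M `<=` DTM R Y ->
  uniformly_bounded M -> preserves_countable_convex M S.
Proof.
move=> MD [L L0 ML] lam mu lam0 lam1 Mmu B _.
apply: series_adjoint_linear => //; first by move=> j; exact: MD.
apply: (@le_lt_trans _ _ (\sum_(0 <= j <oo) L%:E * (lam j)%:E)%E).
  apply: lee_nneseries => [j _ _|j _].
    rewrite mule_ge0 ?lee_fin//; apply: (dtm_ge0 (MD _ (Mmu j)).1).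
    by left; exact: openT.
  by rewrite muleC lee_wpmul2r ?lee_fin//; exact: ML.
by rewrite nneseriesZl ?lam1 ?mule1 ?ltry// => j _; rewrite lee_fin.
Qed.

Lemma series_adjoint_bounded (M : set (wk R Y)) : M `<=` DTM R Y ->
  uniformly_bounded M -> uniformly_bounded (S @` M).
Proof.
(* The [+ 1] keeps the bound positive when all [alpha i] vanish. *)
move=> MD [L L0 ML]; exists (A * L + 1).
  by rewrite ltr_wpDl// mulr_ge0 ?limn_series_ge0// ltW.
move=> _ [mu Mmu <-]; apply: le_trans (series_adjoint_setT_le (MD _ Mmu)) _.
apply: (@le_trans _ _ (A * L)%:E); last by rewrite lee_fin lerDl.
by rewrite EFinM lee_wpmul2l ?lee_fin ?limn_series_ge0//; exact: ML.
Qed.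

Lemma qint_adjoint (i : nat) (mu : set Y -> \bar R) (f : X -> R) :
  DTM R Y mu -> C0pos R X f -> qint (adjoint (q i) mu) f = qint mu (quasi_hom (q i) f).
Proof.
move=> dmu f0; have [c c0 fc] := C0_bounded f0.1.
have qf0 := quasi_hom_C0pos hX hY (dq i) f0.
have fb x : 0 <= f x <= c by rewrite f0.2 (le_trans (ler_norm _)).
have qfb y : 0 <= quasi_hom (q i) f y <= c.
  by rewrite qf0.2 (le_trans (ler_norm _))// (quasi_hom_norm_le _ (dq i) f0.1).
rewrite (qint_pos (dtm_superlevel_monotone (adjoint_dtm hX hY lX rX (dq i) dmu) f0.1.1) fb).
rewrite (qint_pos (dtm_superlevel_monotone dmu qf0.1.1) qfb); congr fine.
apply: eq_integral => t; rewrite inE/= in_itv/= => /andP[t0 _].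
rewrite (quasi_hom_superlevel (dq i) f0.1 t0) adjointE//; left.
by apply: open_superlevel; exact: f0.1.1.
Qed.

Lemma qint_series_adjoint (mu : set Y -> \bar R) (f : X -> R) :
  DTM R Y mu -> C0 R X f ->
  series (fun i => alpha i * qint (adjoint (q i) mu) f) @ \oo --> qint (S mu) f.
Proof.
move=> dmu f0; have [c _ fc] := C0_bounded f0.
apply: (qint_series hX alpha0 _ (series_adjoint_setT_lty dmu) f0.1 fc) => i.
exact: (adjoint_dtm hX hY lX rX (dq i) dmu).
Qed.

(* Weierstrass M-test: on [M] the functional [mu |-> qint (S mu) f] is the series
   of [alpha_i * qint mu (theta_i f)], dominated by [alpha_i * c * L]. *)
Lemma series_adjoint_continuous (M : set (wk R Y)) : M `<=` DTM R Y ->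
  uniformly_bounded M -> {within M, continuous S}.
Proof.
move=> MD [L L0 ML]; apply: wk_coarsest => -[f f0].
have [c c0 fc] := C0_bounded f0.1.
(* As theta_i f is again in [C0pos], it is one of the test functions that define the weak topology
   on the source. *)
pose qf i : {g : Y -> R | C0pos R Y g} :=
  exist _ (quasi_hom (q i) f) (quasi_hom_C0pos hX hY (dq i) f0).
pose h i (mu : wk R Y) : R := alpha i * wk_functional (qf i) mu.
have hM i mu : M mu -> `|h i mu| <= alpha i * (c * L).
  move=> Mmu; rewrite normrM ger0_norm// ler_wpM2l//.
  have dmu := MD _ Mmu; have qf0 := proj2_sig (qf i).
  have qfb y : 0 <= quasi_hom (q i) f y <= c.
    by rewrite qf0.2 (le_trans (ler_norm _))// (quasi_hom_norm_le _ (dq i) f0.1).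
  have := qint_pos_norm_le (dtm_superlevel_monotone dmu qf0.1.1) c0 qfb.
  move=> /le_trans; apply; rewrite ler_wpM2l// -lee_fin fineK; first exact: ML.
  by apply: (dtm_fin_num dmu); left; exact: openT.
have Sh mu : M mu -> wk_functional (exist _ f f0) (S mu) = limn (series (h^~ mu)).
  move=> Mmu; rewrite /wk_functional/=.
  rewrite -(cvg_lim _ (qint_series_adjoint (MD _ Mmu) f0.1))//.
  congr (limn (series _)); apply/funext => i.
  by rewrite (qint_adjoint i (MD _ Mmu) f0).
apply/subspace_continuousP => mu Mmu; rewrite /= Sh//.
have cvS : limn (series (h^~ nu)) @[nu --> within M (nbhs mu)] --> limn (series (h^~ mu)).
  apply: (@cvg_limn_series _ _ _ _ h (fun i => alpha i * (c * L))).
  - exact: is_cvg_seriesMr.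
  - move=> i; apply: cvg_within_filter; apply: cvgMl_tmp.
    exact: wk_functional_continuous.
  - by move=> i; exact: hM.
  (* The bound c L holds on [M], hence eventually along the filter restricted to [M]. *)
  - by apply: filterS (withinT _ _) => nu Mnu i; exact: hM.
apply: cvg_trans cvS; apply: near_eq_cvg.
by apply: filterS (withinT _ _) => nu Mnu /=; rewrite Sh.
Qed.

(** The right-hand side has [m] rather than [mu]: for signed f and d-image transformations the
    superlevel sets of T f are Borel but possibly neither open nor closed. *)
Lemma qint_series_quasi_hom (mu m : set Y -> \bar R) (f : X -> R) :
  DTM R Y mu -> restricts_to m mu -> C0 R X f -> qint (S mu) f = qint m (T f).
Proof.
move=> dmu rm f0; have [c c0 fc] := C0_bounded f0.
have mY : (m [set: Y] < +oo)%E.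
  by rewrite rm.2; [exact: dmu.2|left; exact: openT].
have := qint_borel_series rm.1 mY alpha0 calpha
  (fun i => borel_quasi_hom_superlevel (dq i) f0)
  (fun i y => quasi_hom_norm_le y (dq i) f0 c0 fc).
move=> /(cvg_lim (@Rhausdorff R)) <-.
rewrite -(cvg_lim _ (qint_series_adjoint dmu f0))//.
congr (limn (series _)); apply/funext => i.
by rewrite (qint_borel_quasi_hom hX hY lX rX (dq i) f0 dmu rm).
Qed.

Lemma series_quasi_hom_C0 (f : X -> R) : C0 R X f ->
  (forall i, C0 R Y (quasi_hom (q i) f)) -> C0 R Y (T f).
Proof.
move=> f0 qf0; have [c c0 fc] := C0_bounded f0.
by apply: (C0_limn_series (C := c)) => // i y; exact: quasi_hom_norm_le.
Qed.

Lemma series_quasi_hom_C0pos (f : X -> R) : C0pos R X f -> C0pos R Y (T f).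
Proof.
move=> f0; have [c c0 fc] := C0_bounded f0.1.
have qf0 i := quasi_hom_C0pos hX hY (dq i) f0.
split; first by apply: series_quasi_hom_C0 => [|i]; [exact: f0.1|exact: (qf0 i).1].
move=> y; apply: limr_ge.
  apply: (series_abs_cvg (v := fun i => alpha i * c)) => [i|].
    by rewrite normrM ger0_norm// ler_wpM2l// (quasi_hom_norm_le _ (dq i) f0.1).
  exact: is_cvg_seriesMr.
by apply: nearW => n; apply: sumr_ge0 => i _; rewrite mulr_ge0// (qf0 i).2.
Qed.

(** The classes D and E are parameters so as to serve C0 and the conic case alike. As E consists of
    continuous functions, the superlevel sets of T f are open, and there [m] may be replaced by
    [mu]. *)
Lemma series_adjoint_markov_feller (M : set (wk R Y)) (D : set (X -> R))
    (E : set (Y -> R)) : M `<=` DTM R Y -> D `<=` C0 R X -> E `<=` C0 R Y ->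
  (forall f, D f -> E (T f)) ->
  markov_feller D E (M `&` [set mu | is_measure mu]) S T.
Proof.
move=> MD DC EC DE; split => //.
  by apply: series_adjoint_markov => mu [/MD].
move=> f mu Df [Mmu [m rm]].
rewrite (qint_series_quasi_hom (MD _ Mmu) rm (DC _ Df)); apply: eq_qint => [t|].
  by apply: rm.2; left; apply: open_superlevel; exact: (EC _ (DE _ Df)).1.
by apply: rm.2; left; exact: openT.
Qed.

End SeriesAdjoint.

(** In the deficient half the dual operator acts between the nonnegative cones. Signed f are covered
    by the last clause, where T f, possibly discontinuous, is integrated against the Borel extension
    m of mu. *)
Theorem theorem51 (R : realType) (X Y : metricType R)
    (X_lc : locally_compact [set: X]) (Y_lc : locally_compact [set: Y])
    (M : set (wk R Y)) (M_bounded : uniformly_bounded M)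
    (q : nat -> set X -> set Y)
    (alpha : R^nat) (alpha_ge0 : forall i, 0 <= alpha i)
    (alpha_summable : cvgn (series alpha)) :
  let S : wk R Y -> wk R X := series_adjoint alpha q in
  let T : (X -> R) -> (Y -> R) := series_quasi_hom alpha q in
  (M `<=` TM R Y -> (forall i, image_transformation (q i)) ->
    [/\ S @` M `<=` TM R X,
        {within M, continuous S},
        markov_operator M S,
        preserves_countable_convex M S &
        uniformly_bounded (S @` M) /\
        markov_feller (C0 R X) (C0 R Y) (M `&` [set mu | is_measure mu]) S T])
  /\
  (M `<=` DTM R Y -> (forall i, d_image_transformation (q i)) ->
    [/\ S @` M `<=` DTM R X,
        {within M, continuous S},
        markov_operator M S,
        preserves_countable_convex M S &
        uniformly_bounded (S @` M) /\
        markov_feller (C0pos R X) (C0pos R Y)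
          (M `&` [set mu | is_measure mu]) S T /\
        (forall f mu m, C0 R X f -> M mu -> restricts_to m mu ->
          qint (S mu) f = qint m (T f))]).
Proof.
move=> S T.
have hX : hausdorff_space X := @metric_hausdorff _ X.
have hY : hausdorff_space Y := @metric_hausdorff _ Y.
have rX : regular_space X := @uniform_regular X.
split=> [MTM iq|MDTM dq].
  have dq i := image_transformation_d (iq i).
  have MDTM : M `<=` DTM R Y := subset_trans MTM (@TM_DTM R Y).
  split.
  - move=> _ [mu Mmu <-].
    exact: (series_adjoint_tm hX hY X_lc rX alpha_ge0 alpha_summable dq iq (MTM _ Mmu)).
  - exact: series_adjoint_continuous.
  - exact: series_adjoint_markov.
  - exact: series_adjoint_convex.
  - split; first exact: series_adjoint_bounded.
    apply: series_adjoint_markov_feller => // f f0.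
    apply: (series_quasi_hom_C0 alpha_ge0 alpha_summable dq) => // i.
    exact: (quasi_hom_C0 hX hY (iq i) f0).
split.
- move=> _ [mu Mmu <-].
  exact: (series_adjoint_dtm hX hY X_lc rX alpha_ge0 alpha_summable dq (MDTM _ Mmu)).
- exact: series_adjoint_continuous.
- exact: series_adjoint_markov.
- exact: series_adjoint_convex.
- split; first exact: series_adjoint_bounded.
  split; last first.
    by move=> f mu m f0 /MDTM dmu rm; exact: qint_series_quasi_hom.
  apply: series_adjoint_markov_feller => //; try by move=> f [].
  by move=> f; exact: series_quasi_hom_C0pos.
Qed.
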